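(* Let $g>0$, $\rho_+>\rho_->0$, $[\rho]:=\rho_+-\rho_->0$, $\mu_\pm>0$ and $B\in\mathbb{R}\setminus\{0\}$. For $\xi\in\mathbb{R}$ and $\lambda>0$ consider the problem (horizontal magnetic field) of finding $\psi:[-1,1]\to\mathbb{R}$, whose restrictions to $[-1,0]$ and $[0,1]$ are $C^4$, such that on $(-1,0)\cup(0,1)$ $$-\lambda^2\rho(\xi^2\psi-\psi'')=\mu\lambda(\xi^4\psi-2\xi^2\psi''+\psi'''')+|B|^2(\xi^4\psi-\xi^2\psi''),$$ with the jump conditions $$\llbracket\psi\rrbracket=\llbracket\psi'\rrbracket=0,\qquad \llbracket\mu\lambda(\xi^2\psi+\psi'')\rrbracket=0,\qquad \llbracket\mu\lambda(\psi'''-3\xi^2\psi')\rrbracket=\llbracket\lambda^2\rho\psi'\rrbracket+g[\rho]\xi^2\psi(0),$$ and the boundary conditions $\psi(-1)=\psi(1)=\psi'(-1)=\psi'(1)=0$. Then: (i) if $|B|\ge|B|_c$, then for every $\xi\in\mathbb{R}$ there is no nontrivial solution $\psi$ with $\lambda>0$; (ii) if $|B|<|B|_c$, then for every $\xi\in\mathbb{R}$ with $|\xi|\ge|\xi|_{hc}^B$ there is no nontrivial solution $\psi$ with $\lambda>0$; (iii) if $|B|<|B|_c$, then for every $\xi\in\mathbb{R}$ with $0<|\xi|<|\xi|^B_{hc}$ there exist $\lambda(\xi)>0$ and a solution $\psi=\psi(\xi,x_2)$ of the problem; moreover $\psi$ and $\lambda$ are even in $\xi$, $\psi$ is smooth when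 restricted to $(-1,0)$ or $(0,1)$, and $\psi(\xi,0)\neq0$.
   Context: Here $\rho(x_2)=\rho_+$ and $\mu(x_2)=\mu_+$ for $x_2\in(0,1)$, $\rho(x_2)=\rho_-$ and $\mu(x_2)=\mu_-$ for $x_2\in(-1,0)$; primes denote $d/dx_2$; $\llbracket f\rrbracket:=f(0^+)-f(0^-)$. The critical magnetic number is $|B|_c^2:=\sup\{ g[\rho]\psi(0)^2/\int_{-1}^1|\psi'|^2dx_2 : \psi\in H_0^1((-1,1)),\ \psi\ne0\}$. For $|B|<|B|_c$ the critical frequency is $(|\xi|^B_{hc})^2:=\sup\Big\{\frac{g[\rho]\psi(0)^2-|B|^2\int_{-1}^1|\psi'|^2dx_2}{|B|^2\int_{-1}^1|\psi|^2dx_2}:\ \psi\in H_0^1((-1,1)),\ \psi\neq0\Big\}$. The ODE problem arises from normal modes of the linearized 2D viscous, zero-resistivity MHD Rayleigh–Taylor problem in the slab $\mathbb{R}\times(-1,1)$ with constant horizontal magnetic field $(B,0)$. *)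

(* Defs.v *)
From HB Require Import structures.
From mathcomp Require Import all_boot all_order all_algebra.
From mathcomp Require Import all_classical all_reals all_analysis.
Set Implicit Arguments. Unset Strict Implicit. Unset Printing Implicit Defensive.
Import Order.TTheory GRing.Theory Num.Theory.
Import numFieldNormedType.Exports.
Local Open Scope classical_set_scope.
Local Open Scope ring_scope.

Section Defs.
Variable R : realType.
Local Notation mu := (@lebesgue_measure R).

(** H_0^1((-1,1)) in dimension one: [psi] is the (continuous representative)
    of an H_0^1 function whose weak derivative is [dpsi] : dpsi is in L^2(-1,1),
    psi x = int_{-1}^x dpsi on [-1,1], and psi(1) = 0 (psi(-1) = 0 automatically). *)
Definition H01 (psi dpsi : R -> R) : Prop :=
  measurable_fun `[(-1 : R), 1] dpsi /\
  mu.-integrable `[(-1 : R), 1] (EFin \o dpsi) /\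
  mu.-integrable `[(-1 : R), 1] (fun x => (dpsi x ^+ 2)%:E) /\
  (forall x, -1 <= x <= 1 -> psi x = Rintegral mu `[(-1 : R), x] dpsi) /\
  psi 1 = 0.

Definition nonzero_on (psi : R -> R) : Prop := exists x, -1 < x < 1 /\ psi x != 0.

Definition L2sq (f : R -> R) : R := Rintegral mu `[(-1 : R), 1] (fun x => f x ^+ 2).

(** critical magnetic number squared |B|_c^2 (grho stands for g[rho]) *)
Definition Bc2 (grho : R) : R :=
  sup [set r | exists psi dpsi, H01 psi dpsi /\ nonzero_on psi /\
               r = grho * psi 0 ^+ 2 / L2sq dpsi].
Definition Bc (grho : R) : R := Num.sqrt (Bc2 grho).

Definition xihc2 (grho B : R) : R :=
  sup [set r | exists psi dpsi, H01 psi dpsi /\ nonzero_on psi /\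
               r = (grho * psi 0 ^+ 2 - B ^+ 2 * L2sq dpsi) / (B ^+ 2 * L2sq psi)].
Definition xihc (grho B : R) : R := Num.sqrt (xihc2 grho B).

Definition rlim (f : R -> R) (a : R) : R := lim (f @ at_right a).
Definition llim (f : R -> R) (a : R) : R := lim (f @ at_left a).

(** The restriction of f to [a,b] is C^k: derivatives up to order k exist and are
    continuous on (a,b) and extend continuously to [a,b] (with f itself equal
    to its one-sided limits at a and b). *)
Definition Ck_closed (k : nat) (f : R -> R) (a b : R) : Prop :=
  (forall n, (n < k)%N -> forall x, a < x < b -> derivable (derive1n n f) x 1) /\
  (forall x, a < x < b -> {for x, continuous (derive1n k f)}) /\
  (forall n, (n <= k)%N ->
     cvg (derive1n n f @ at_right a) /\ cvg (derive1n n f @ at_left b)) /\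
  f a = rlim f a /\ f b = llim f b.

Definition smooth_open (f : R -> R) (a b : R) : Prop :=
  forall n, forall x, a < x < b -> derivable (derive1n n f) x 1.

Definition ode_at (rho mu_ B xi lam : R) (psi : R -> R) (x : R) : Prop :=
  let d n := derive1n n psi x in
  - (lam ^+ 2 * rho * (xi ^+ 2 * d 0%N - d 2%N)) =
    mu_ * lam * (xi ^+ 4 * d 0%N - 2 * xi ^+ 2 * d 2%N + d 4%N)
    + B ^+ 2 * (xi ^+ 4 * d 0%N - xi ^+ 2 * d 2%N).

Definition is_solution (g rhop rhom mup mum B xi lam : R) (psi : R -> R) : Prop :=
  let dp n := rlim (derive1n n psi) 0 in
  let dm n := llim (derive1n n psi) 0 in
  Ck_closed 4 psi (-1) 0 /\ Ck_closed 4 psi 0 1 /\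
  (forall x, 0 < x < 1 -> ode_at rhop mup B xi lam psi x) /\
  (forall x, -1 < x < 0 -> ode_at rhom mum B xi lam psi x) /\
  dp 0%N - dm 0%N = 0 /\
  dp 1%N - dm 1%N = 0 /\
  mup * lam * (xi ^+ 2 * dp 0%N + dp 2%N) - mum * lam * (xi ^+ 2 * dm 0%N + dm 2%N) = 0 /\
  mup * lam * (dp 3%N - 3 * xi ^+ 2 * dp 1%N) - mum * lam * (dm 3%N - 3 * xi ^+ 2 * dm 1%N)
    = (lam ^+ 2 * rhop * dp 1%N - lam ^+ 2 * rhom * dm 1%N)
      + g * (rhop - rhom) * xi ^+ 2 * psi 0 /\
  psi (-1) = 0 /\ psi 1 = 0 /\
  rlim (derive1n 1 psi) (-1) = 0 /\ llim (derive1n 1 psi) 1 = 0.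

Definition nontrivial (psi : R -> R) : Prop := exists x, -1 <= x <= 1 /\ psi x != 0.

End Defs.

(* Main.v *)
(* The flux J = lam^2 rho psi psi' + mu lam (4 xi^2 psi psi' - psi psi''' + psi' psi'')
   + B^2 xi^2 psi psi' of a solution is a primitive of a sum of squares, so adding both sides
   of the interface gives the energy identity
     lam^2 int rho (xi^2 psi^2 + psi'^2) + lam int mu ((xi^2 psi + psi'')^2 + 4 xi^2 psi'^2)
       = xi^2 (g[rho] psi(0)^2 - B^2 int (xi^2 psi^2 + psi'^2)).
   Above the critical numbers the right-hand side is nonpositive, which proves (i) and (ii).

   For (iii) no variational argument is needed: the characteristic roots are +-xi and +-s with
   s^2 = xi^2 + (lam^2 rho + B^2 xi^2) / (mu lam), so on each side the solution with
   psi(0) = a, psi'(0) = b and clamped at the wall is explicit. The last two jump conditions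
   become a symmetric 2x2 system M(lam)(a, b) = (g[rho] xi^2 a, 0), which has a solution with
   a = M11 > 0 as soon as det M - g[rho] xi^2 M11 vanishes. This continuous function of lam is
   nonnegative for large lam by the energy identity, and negative for small lam because then
   M00 tends to 2 B^2 xi^3 coth xi, which is below g[rho] xi^2 exactly when |xi| is subcritical:
   int (psi'^2 + xi^2 psi^2) >= 2 xi coth xi psi(0)^2 on H_0^1, by comparison with
   sinh (xi (1 - |x|)). *)

Require Import Defs.
From HB Require Import structures.
From mathcomp Require Import all_boot all_order all_algebra.
From mathcomp Require Import all_classical all_reals all_analysis.
From mathcomp Require Import measurable_realfun ring lra.
Import Order.TTheory GRing.Theory Num.Theory.
Import numFieldNormedType.Exports.
Local Open Scope classical_set_scope.
Local Open Scope ring_scope.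
Set Implicit Arguments. Unset Strict Implicit. Unset Printing Implicit Defensive.

(** * Continuity of real functions under pointwise arithmetic *)

Section ContinuousReal.
Variable R : realType.
Implicit Types (f g : R -> R).

Lemma continuous_realM f g : continuous f -> continuous g -> continuous (fun x => f x * g x).
Proof. by move=> cf cg x; apply: cvgM; [exact: cf|exact: cg]. Qed.

Lemma continuous_realD f g : continuous f -> continuous g -> continuous (fun x => f x + g x).
Proof. by move=> cf cg x; apply: cvgD; [exact: cf|exact: cg]. Qed.

Lemma continuous_realB f g : continuous f -> continuous g -> continuous (fun x => f x - g x).
Proof. by move=> cf cg x; apply: cvgB; [exact: cf|exact: cg]. Qed.

Lemma continuous_real_cst (k : R) : continuous (fun _ : R => k).
Proof. by move=> x; exact: cvg_cst. Qed.

Lemma is_derive_continuous (f df : R -> R) :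
  (forall x : R, is_derive x 1 f (df x)) -> continuous f.
Proof.
move=> fd x; apply: differentiable_continuous; apply/derivable1_diffP.
exact: (@ex_derive _ _ _ _ _ _ _ (fd x)).
Qed.

End ContinuousReal.

Ltac continuity_real :=
  repeat match goal with
  | |- forall x, continuous_at x (fun _ => ?k) => exact: continuous_real_cst
  | |- forall x, continuous_at x (fun y => (@?f y * @?g y)%R) =>
      apply: (@continuous_realM _ f g)
  | |- forall x, continuous_at x (fun y => (@?f y - @?g y)%R) =>
      apply: (@continuous_realB _ f g)
  | |- forall x, continuous_at x (fun y => (@?f y + @?g y)%R) =>
      apply: (@continuous_realD _ f g)
  | |- forall x, continuous_at x _ => assumption
  end.

(** * Integration on intervals *)

Section IntervalIntegral.
Variable R : realType.
Implicit Types (a b c k x y : R) (f g h : R -> R).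
Local Notation leb := (@lebesgue_measure R).
Local Notation itg a b f := (leb.-integrable `[a, b] (EFin \o f)).
Local Notation int a b f := (Rintegral leb `[a, b] f).

Lemma integrable_subitv a b c d f :
  a <= c -> d <= b -> itg a b f -> itg c d f.
Proof.
move=> ac db; apply: integrableS => //.
by apply: subset_itv; rewrite bnd_simp.
Qed.

Lemma Rintegral_itv_cat a c b f : a <= c -> c <= b -> itg a b f ->
  int a b f = int a c f + int c b f.
Proof.
move=> ac cb fi; apply/eqP; rewrite addrC -subr_eq; apply/eqP.
rewrite Rintegral_itvB ?bnd_simp// Rintegral_itv_obnd_cbnd//.
apply: integrableS fi => //; apply: subset_itv; by rewrite bnd_simp.
Qed.

Lemma integrable_itvD a b f g : itg a b f -> itg a b g ->
  itg a b (fun x => f x + g x).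
Proof. by move=> fi gi; apply: eq_integrable (integrableD _ fi gi). Qed.

Lemma integrable_itvZ a b k f : itg a b f -> itg a b (fun x => k * f x).
Proof. by move=> fi; apply: eq_integrable (integrableZl _ k fi). Qed.

Lemma integrable_itv_within a b f :
  {within `[a, b], continuous f} -> itg a b f.
Proof.
by move=> fc; apply: continuous_compact_integrable => //; exact: segment_compact.
Qed.

Lemma integrable_itv_cts a b f : continuous f -> itg a b f.
Proof. by move=> fc; apply: integrable_itv_within; exact: continuous_subspaceT. Qed.

Lemma eq_Rintegral_itv a b f g : (forall x, a <= x -> x <= b -> f x = g x) ->
  int a b f = int a b g.
Proof.
move=> fg; apply: eq_Rintegral => x; rewrite inE/= in_itv/= => /andP[ax xb].
exact: fg.
Qed.

Lemma Rintegral_itv_cst a b k : a <= b -> int a b (fun=> k) = k * (b - a).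
Proof.
move=> ab; rewrite Rintegral_cst//= lebesgue_measure_itv/= lte_fin.
move: ab; rewrite le_eqVlt => /predU1P[->|->] //=; by rewrite ltxx subrr.
Qed.

(* The square of [f] minus its mean value has nonnegative integral. *)
Lemma Rintegral_itv_CS a b f : a <= b -> itg a b f -> itg a b (fun x => f x ^+ 2) ->
  int a b f ^+ 2 <= (b - a) * int a b (fun x => f x ^+ 2).
Proof.
rewrite le_eqVlt => /predU1P[<- _ _|ab fi f2i].
  by rewrite set_itv1 !Rintegral_set1 mulr0 expr0n.
set I := int a b f; set J := int a b _.
pose k := I / (b - a).
have ba0 : 0 < b - a by rewrite subr_gt0.
have : 0 <= int a b (fun x => f x ^+ 2 + (- (2 * k) * f x + k ^+ 2)).
  apply: Rintegral_ge0 => x _.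
  rewrite (_ : _ + _ = (f x - k) ^+ 2) ?sqr_ge0//; ring.
have ki : itg a b (fun=> k ^+ 2) by apply: integrable_itv_cts => ?; exact: cvg_cst.
rewrite RintegralD//; last by apply: integrable_itvD => //; exact: integrable_itvZ.
rewrite RintegralD//; last exact: integrable_itvZ.
rewrite RintegralZl// (Rintegral_itv_cst _ (ltW ab)) -/I -/J => h.
have kI : k * (b - a) = I by rewrite /k mulfVK// gt_eqF.
have : 0 <= (b - a) * (J + (- (2 * k) * I + k ^+ 2 * (b - a))).
  by apply: mulr_ge0 h; rewrite ltW.
rewrite (_ : _ * (_ + _) = (b - a) * J - I ^+ 2) ?subr_ge0//.
rewrite -kI; ring.
Qed.

Lemma integrable_itvMcts a b f h : continuous h -> itg a b f ->
  itg a b (fun x => f x * h x).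
Proof.
move=> hc fi; suff : leb.-integrable `[a, b] ((EFin \o f) \* (EFin \o h))%E.
  exact: eq_integrable.
apply: integrableMl => //.
  by apply: measurable_funTS; exact: continuous_measurable_fun.
have hw : {within `[a, b], continuous h} by exact: continuous_subspaceT.
have [M [Mr MP]] : bounded_set (h @` `[a, b]).
  by apply/compact_bounded/continuous_compact => //; exact: segment_compact.
by exists M; split => // N MN x xab; apply: (MP N MN); exists x.
Qed.

Lemma Rintegral_itv_FTC2 a b f g : a <= b -> continuous f -> continuous g ->
  (forall x, a < x -> x < b -> is_derive x 1 f (g x)) -> int a b g = f b - f a.
Proof.
rewrite le_eqVlt => /predU1P[<- _ _ _|ab fc gc fg].
  by rewrite set_itv1 Rintegral_set1 subrr.
rewrite /Rintegral (@continuous_FTC2 _ g f)//.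
- exact: continuous_subspaceT.
- split.
  + move=> x; rewrite in_itv/= => /andP[ax xb].
    exact: (@ex_derive _ _ _ _ _ _ _ (fg x ax xb)).
  + by apply: cvg_at_right_filter; exact: fc.
  + by apply: cvg_at_left_filter; exact: fc.
- move=> x; rewrite in_itv/= => /andP[ax xb].
  have h1 := fg x ax xb; rewrite derive1E; exact: derive_val.
Qed.

(* Cutting [a, b] into n pieces bounds |N b - N a| by a multiple of 1/n. *)
Lemma increment_eq0 a b (C : R) (N V : R -> R) : a <= b ->
  (forall x y, a <= x -> x <= y -> y <= b ->
     `|N y - N x| <= C * (y - x) * (V y - V x)) -> N b = N a.
Proof.
move=> ab NV; apply/eqP; rewrite -subr_eq0 -normr_eq0; apply/eqP/le_anti.
rewrite normr_ge0 andbT leNgt; apply/negP => pos.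
have [n Hn] : exists n : nat, C * (b - a) * (V b - V a) / n.+1%:R < `|N b - N a|.
  have := archi_boundP (normr_ge0 (C * (b - a) * (V b - V a) / `|N b - N a|)).
  set m := Num.bound _ => hm; exists m.
  have : C * (b - a) * (V b - V a) / `|N b - N a| < m.+1%:R.
    apply: le_lt_trans (ler_norm _) _; apply: lt_le_trans hm _.
    by rewrite ler_nat.
  by rewrite !ltr_pdivrMr// [X in _ < X -> _]mulrC.
pose h := (b - a) / n.+1%:R.
have h0 : 0 <= h by rewrite /h divr_ge0// subr_ge0.
have hn : h * n.+1%:R = b - a by rewrite /h mulfVK.
have step : forall i : nat, (i <= n.+1)%N ->
   `|N (a + h * i%:R) - N a| <= C * h * (V (a + h * i%:R) - V a).
  elim=> [|i IH] iN; first by rewrite mulr0 addr0 !subrr normr0 mulr0.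
  have {}IH := IH (ltnW iN).
  have e : h * i.+1%:R = h * i%:R + h by rewrite -natr1; ring.
  have := NV (a + h * i%:R) (a + h * i.+1%:R).
  have -> : a + h * i.+1%:R - (a + h * i%:R) = h by rewrite e; ring.
  have ih0 : 0 <= h * i%:R by rewrite mulr_ge0.
  have ib : a + h * i.+1%:R <= b.
    by rewrite -lerBrDl -hn ler_wpM2l// ler_nat.
  move=> /(_ _ _ ib) {}NV.
  have {}NV : `|N (a + h * i.+1%:R) - N (a + h * i%:R)| <=
     C * h * (V (a + h * i.+1%:R) - V (a + h * i%:R)).
    by apply: NV; [rewrite lerDl | rewrite e addrA lerDl].
  rewrite (_ : N _ - N a = (N (a + h * i.+1%:R) - N (a + h * i%:R))
    + (N (a + h * i%:R) - N a)); last by ring.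
  apply: le_trans (ler_normD _ _) _.
  apply: le_trans (lerD NV IH) _.
  rewrite le_eqVlt; apply/orP; left; apply/eqP; ring.
have := step n.+1 (leqnn _); rewrite hn.
have -> : a + (b - a) = b by ring.
have -> : C * h * (V b - V a) = C * (b - a) * (V b - V a) / n.+1%:R by rewrite /h; ring.
by rewrite leNgt Hn.
Qed.

Lemma primitive_within_continuous a b f F : a <= b -> itg a b f ->
  (forall x, a <= x -> x <= b -> F x = F a + int a x f) ->
  {within `[a, b], continuous F}.
Proof.
move=> ab fi FE.
apply: (@subspace_eq_continuous _ _ _ (fun x => F a + int a x f)).
  by move=> x; rewrite inE/= in_itv/= => /andP[ax xb]; rewrite -FE.
have := parameterized_integral_continuous ab fi => cP.
by move=> x; apply: cvgD; [exact: cvg_cst | exact: cP].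
Qed.

(** As [f] is merely integrable, the product F h need not be differentiable everywhere. Instead the
    defect [N] has increments over [x, y] bounded by y - x times the integral of |f| over [x, y],
    and [increment_eq0] makes it constant. *)
Lemma integration_by_parts_ac a b f F h dh : a <= b -> itg a b f ->
  (forall x, a <= x -> x <= b -> F x = F a + int a x f) ->
  (forall x, is_derive x 1 h (dh x)) -> continuous dh ->
  itg a b (fun x => F x * dh x) /\
  int a b (fun x => f x * h x) + int a b (fun x => F x * dh x) =
  F b * h b - F a * h a.
Proof.
move=> ab fi FE hd dhc.
have hc := is_derive_continuous hd.
have Fw := primitive_within_continuous ab fi FE.
have Fdhi : itg a b (fun x => F x * dh x).
  apply: integrable_itv_within => x.
  by apply: cvgM; [exact: Fw|exact: continuous_subspaceT].
split => //.
have fhi : itg a b (fun x => f x * h x) by exact: integrable_itvMcts.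
have nfi : itg a b (fun x => `|f x|) by exact: integrable_norm.
have FB : forall x y, a <= x -> x <= y -> y <= b -> F y - F x = int x y f.
  move=> x y ax xy yb.
  rewrite (FE y) ?(le_trans ax)// (FE x) ?(le_trans xy)//.
  rewrite (Rintegral_itv_cat ax xy); first by ring.
  exact: integrable_subitv fi.
have [C CP] : exists C, forall x, x \in `[a, b] -> `|dh x| <= C.
  have [|c cab cm] := @EVT_max R (fun x => `|dh x|) a b ab.
    by apply: continuous_subspaceT => x; apply: cvg_norm; exact: dhc.
  by exists `|dh c|.
have C0 : 0 <= C.
  by apply: le_trans (CP a _); rewrite ?normr_ge0// in_itv/= lexx.
pose G x := f x * h x + F x * dh x.
have Gi : itg a b G by exact: integrable_itvD.
pose N x := F x * h x - int a x G.
pose V x := int a x (fun x => `|f x|).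
suff : N b = N a.
  rewrite /N /G set_itv1 Rintegral_set1 RintegralD// => e; lra.
apply: (@increment_eq0 a b (2 * C) N V ab) => x y ax xy yb.
have xb := le_trans xy yb; have ay := le_trans ax xy.
have Gxy := integrable_subitv ax yb Gi.
have fxy := integrable_subitv ax yb fi.
have nfxy := integrable_subitv ax yb nfi.
have -> : V y - V x = int x y (fun x => `|f x|).
  rewrite /V (Rintegral_itv_cat ax xy); first by ring.
  exact: integrable_subitv nfi.
set W := int x y _.
(* Freezing h at y and F at x writes the increment of F h as a single integral. Subtracting [G]
   leaves f paired with h y - h s and dh paired with F x - F s, both small. *)
pose K s := (h y * f s + F x * dh s) - G s.
have dhi u v : itg u v dh by exact: integrable_itv_cts.
have K1i : itg x y (fun s => h y * f s + F x * dh s).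
  by apply: integrable_itvD; apply: integrable_itvZ.
have -> : N y - N x = int x y K.
  rewrite RintegralB// RintegralD; [|by []|exact: integrable_itvZ|exact: integrable_itvZ].
  rewrite !RintegralZl// -FB// (@Rintegral_itv_FTC2 _ _ h)// /N.
  rewrite (Rintegral_itv_cat ax xy); first by ring.
  exact: integrable_subitv Gi.
have Ki : itg x y K.
  apply: eq_integrable (integrable_itvD K1i (integrable_itvZ (-1) Gxy)) => //.
  by move=> s _ /=; rewrite /K mulN1r.
apply: le_trans (le_normr_Rintegral _ Ki) _ => //.
(* The mean value theorem bounds h y - h s by C (y - x), and F x - F s is at most [W]. Integrating
   gives C (y - x) W twice, hence the constant 2 C. *)
have step : forall s, `[x, y]%classic s ->
    `|K s| <= (C * (y - x)) * `|f s| + C * W.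
  move=> s /=; rewrite in_itv/= => /andP[xs sy].
  have -> : K s = f s * (h y - h s) + (F x - F s) * dh s by rewrite /K /G; ring.
  apply: le_trans (ler_normD _ _) _; rewrite !normrM; apply: lerD.
    rewrite mulrC ler_wpM2r//.
    have [|c cs ->] := @MVT_segment R h dh s y sy (fun z _ => hd z).
      by apply: continuous_subspaceT.
    rewrite normrM; apply: ler_pM => //.
      apply: CP; move: cs; rewrite !in_itv/= => /andP[sc cy].
      by rewrite (le_trans ax (le_trans xs sc)) (le_trans cy).
    by rewrite ger0_norm ?subr_ge0// lerB.
  rewrite mulrC; apply: ler_pM => //.
    by apply: CP; rewrite in_itv/= (le_trans ax)// (le_trans sy).
  rewrite distrC FB// ?(le_trans sy)//.
  apply: le_trans (le_normr_Rintegral _ _) _ => //.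
    exact: integrable_subitv fxy.
  rewrite /W (Rintegral_itv_cat xs sy)// lerDl; exact: Rintegral_ge0.
apply: (@le_trans _ _ (int x y (fun s => (C * (y - x)) * `|f s| + C * W))).
  apply: le_Rintegral => //; first exact: integrable_norm.
  apply: integrable_itvD; first exact: integrable_itvZ.
  by apply: integrable_itv_cts => ?; exact: cvg_cst.
rewrite RintegralD//; last 2 first.
- exact: integrable_itvZ.
- by apply: integrable_itv_cts => ?; exact: cvg_cst.
rewrite RintegralZl// Rintegral_itv_cst// -/W.
rewrite le_eqVlt; apply/orP; left; apply/eqP; ring.
Qed.

End IntervalIntegral.

(** * Hyperbolic functions and bounds on H_0^1 *)

Section Hyperbolic.
Variable R : realType.
Implicit Types (k e x y s d : R).

Definition ch x : R := (expR x + expR (- x)) / 2.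
Definition sh x : R := (expR x - expR (- x)) / 2.

Lemma is_derive_ch x : is_derive x 1 ch (sh x).
Proof. by rewrite /ch /sh; apply: is_derive_eq; rewrite /GRing.scale/=; field. Qed.

Lemma is_derive_sh x : is_derive x 1 sh (ch x).
Proof. by rewrite /ch /sh; apply: is_derive_eq; rewrite /GRing.scale/=; field. Qed.

Lemma continuous_ch : continuous ch.
Proof. exact: (is_derive_continuous is_derive_ch). Qed.

Lemma continuous_sh : continuous sh.
Proof. exact: (is_derive_continuous is_derive_sh). Qed.

Lemma ch2_sub_sh2 x : ch x ^+ 2 - sh x ^+ 2 = 1.
Proof.
have e : expR x * expR (- x) = 1 by rewrite -expRD subrr expR0.
by rewrite /ch /sh -{}[RHS]e; field.
Qed.

Lemma chD x y : ch (x + y) = ch x * ch y + sh x * sh y.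
Proof. by rewrite /ch /sh opprD !expRD; field. Qed.

Lemma shD x y : sh (x + y) = sh x * ch y + ch x * sh y.
Proof. by rewrite /ch /sh opprD !expRD; field. Qed.

Lemma chN x : ch (- x) = ch x.
Proof. by rewrite /ch opprK addrC. Qed.

Lemma shN x : sh (- x) = - sh x.
Proof. by rewrite /sh opprK; field. Qed.

Lemma ch0 : ch 0 = 1.
Proof. by rewrite /ch oppr0 expR0; field. Qed.

Lemma sh0 : sh 0 = 0.
Proof. by rewrite /sh oppr0 subrr mul0r. Qed.

Lemma ch_gt0 x : 0 < ch x.
Proof. by rewrite /ch divr_gt0// addr_gt0// expR_gt0. Qed.

Lemma sh_gt0 x : 0 < x -> 0 < sh x.
Proof. by move=> x0; rewrite /sh divr_gt0// subr_gt0 ltr_expR; lra. Qed.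

Lemma sh_le_ch x : sh x <= ch x.
Proof. rewrite /sh /ch; have := expR_gt0 (- x); lra. Qed.

(** From exp (2 x) >= 1 + 2 x >= 3, exp (- x) is at most a third of exp x. *)
Lemma ch_le_sh2 x : 1 <= x -> ch x <= 2 * sh x.
Proof.
move=> x1.
have e3 : 3 * expR (- x) <= expR x.
  have e : expR x * expR (- x) = 1 by rewrite -expRD subrr expR0.
  have h : 3 <= expR x * expR x.
    by rewrite -expRD; apply: le_trans (expR_ge1Dx _); lra.
  have : 3 * expR (- x) <= expR x * expR x * expR (- x).
    by rewrite ler_wpM2r// expR_ge0.
  by rewrite -mulrA e mulr1.
rewrite /ch /sh; lra.
Qed.

(** Twice the difference factors as (e^y - e^x) (1 - e^(-x) e^(-y)). *)
Lemma lt_ch x y : 0 < x -> x < y -> ch x < ch y.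
Proof.
move=> x0 xy.
have e : expR (- x) - expR (- y) = (expR y - expR x) * (expR (- x) * expR (- y)).
  have e1 : expR x * expR (- x) = 1 by rewrite -expRD subrr expR0.
  have e2 : expR y * expR (- y) = 1 by rewrite -expRD subrr expR0.
  rewrite mulrBl mulrA [expR y * _]mulrC -mulrA e2 mulr1.
  by rewrite mulrA e1 mul1r.
have p : 0 < expR y - expR x by rewrite subr_gt0 ltr_expR.
have q : expR (- x) * expR (- y) < 1.
  by rewrite -expRD -[X in _ < X]expR0 ltr_expR; lra.
have : (expR y - expR x) * (expR (- x) * expR (- y)) < (expR y - expR x).
  by rewrite gtr_pMr.
rewrite -e /ch; lra.
Qed.

(** Convexity of sinh on the positive axis: the chord over [0, d] has slope cosh c1, the chord over
    [d, s] slope cosh c2, with c1 < d < c2. *)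
Lemma sh_ratio_lt d s : 0 < d -> d < s -> s * sh d < d * sh s.
Proof.
move=> d0 ds.
have cs a b : {within `[a, b], continuous sh}.
  exact: continuous_subspaceT continuous_sh.
have [c1] := @MVT R sh ch 0 d d0 (fun z _ => is_derive_sh z) (cs _ _).
rewrite in_itv/= sh0 !subr0 => /andP[c10 c1d] e1.
have [c2] := @MVT R sh ch d s ds (fun z _ => is_derive_sh z) (cs _ _).
rewrite in_itv/= => /andP[dc2 c2s] e2.
have lt12 : ch c1 < ch c2 by apply: lt_ch => //; lra.
rewrite -subr_gt0 (_ : _ - _ = d * (s - d) * (ch c2 - ch c1)).
  by rewrite !mulr_gt0// subr_gt0.
have -> : sh s = sh d + ch c2 * (s - d) by rewrite -e2; ring.
rewrite e1; ring.
Qed.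

(** The sign e selects the side: e = 1 on [-1, 0] and e = -1 on [0, 1], so that 1 + e x is the
    distance from x to the wall. *)
Definition chs k e x : R := ch (k * (1 + e * x)).
Definition shs k e x : R := sh (k * (1 + e * x)).

Lemma is_derive_affine k e x : is_derive x 1 (fun x => k * (1 + e * x)) (k * e).
Proof. by apply: is_derive_eq; rewrite /GRing.scale/=; ring. Qed.

Lemma is_derive_chs k e x : is_derive x 1 (chs k e) (k * e * shs k e x).
Proof.
have := @is_derive1_comp R ch (fun x => k * (1 + e * x)) x _ _
  (is_derive_ch _) (is_derive_affine k e x).
by move=> h; apply: (is_derive_eq h); rewrite mulrC.
Qed.

Lemma is_derive_shs k e x : is_derive x 1 (shs k e) (k * e * chs k e x).
Proof.
have := @is_derive1_comp R sh (fun x => k * (1 + e * x)) x _ _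
  (is_derive_sh _) (is_derive_affine k e x).
by move=> h; apply: (is_derive_eq h); rewrite mulrC.
Qed.

Lemma chs0 k e : chs k e 0 = ch k.
Proof. by rewrite /chs mulr0 addr0 mulr1. Qed.

Lemma shs0 k e : shs k e 0 = sh k.
Proof. by rewrite /shs mulr0 addr0 mulr1. Qed.

Lemma chs_end k e x : e * x = -1 -> chs k e x = 1.
Proof. by rewrite /chs => ->; rewrite subrr mulr0 ch0. Qed.

Lemma shs_end k e x : e * x = -1 -> shs k e x = 0.
Proof. by rewrite /shs => ->; rewrite subrr mulr0 sh0. Qed.

End Hyperbolic.

(** * Trace inequalities on H_0^1 and the two critical numbers *)

Section Sobolev.
Variable R : realType.
Implicit Types (a b c k x y grho B xi : R) (f g h psi dpsi : R -> R).
Local Notation leb := (@lebesgue_measure R).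
Local Notation itg a b f := (leb.-integrable `[a, b] (EFin \o f)).
Local Notation int a b f := (Rintegral leb `[a, b] f).

(* Expand the square of the distance to [c * phi] and integrate by parts, using phi'' = k^2 phi. *)
Lemma ac_energy_ge a b f F phi dphi k c : a <= b ->
  itg a b f -> itg a b (fun x => f x ^+ 2) ->
  (forall x, a <= x -> x <= b -> F x = F a + int a x f) ->
  (forall x, is_derive x 1 phi (dphi x)) ->
  (forall x, is_derive x 1 dphi (k ^+ 2 * phi x)) ->
  2 * c * (F b * dphi b - F a * dphi a)
    - c ^+ 2 * (phi b * dphi b - phi a * dphi a) <=
  int a b (fun x => f x ^+ 2) + k ^+ 2 * int a b (fun x => F x ^+ 2).
Proof.
move=> ab fi f2i FE dp ddp.
have pc := is_derive_continuous dp; have dpc := is_derive_continuous ddp.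
have kpc : continuous (fun x => k ^+ 2 * phi x).
  by move=> x; apply: cvgM; [exact: cvg_cst|exact: pc].
have F2i : itg a b (fun x => F x ^+ 2).
  apply: integrable_itv_within.
  have Fw := primitive_within_continuous ab fi FE.
  by move=> x; apply: cvgM; exact: Fw.
have [Fpi <-] := integration_by_parts_ac ab fi FE ddp kpc.
have fpi : itg a b (fun x => f x * dphi x) by exact: integrable_itvMcts.
pose w x := dphi x * dphi x + phi x * (k ^+ 2 * phi x).
have wc : continuous w.
  move=> x; apply: cvgD; first by apply: cvgM; exact: dpc.
  by apply: cvgM; [exact: pc|exact: kpc].
have <- : int a b w = phi b * dphi b - phi a * dphi a.
  apply: (@Rintegral_itv_FTC2 _ _ _ (fun x => phi x * dphi x)) => //.
    by move=> x; apply: cvgM; [exact: pc|exact: dpc].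
  move=> x _ _.
  have h1 := dp x; have h2 := ddp x.
  by apply: is_derive_eq; rewrite /w /GRing.scale/=; ring.
have wi : itg a b w by exact: integrable_itv_cts.
have : 0 <= int a b (fun x => (f x ^+ 2 + k ^+ 2 * F x ^+ 2) +
    ((- (2 * c)) * (f x * dphi x + F x * (k ^+ 2 * phi x)) + c ^+ 2 * w x)).
  apply: Rintegral_ge0 => x _.
  rewrite (_ : _ + _ = (f x - c * dphi x) ^+ 2 + (k * (F x - c * phi x)) ^+ 2).
    by rewrite addr_ge0// sqr_ge0.
  rewrite /w; ring.
have i1 : itg a b (fun x => k ^+ 2 * F x ^+ 2) by exact: integrable_itvZ.
have i2 : itg a b (fun x => f x * dphi x + F x * (k ^+ 2 * phi x)).
  exact: integrable_itvD.
have i3 : itg a b (fun x => - (2 * c) * (f x * dphi x + F x * (k ^+ 2 * phi x))).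
  exact: integrable_itvZ.
have i4 : itg a b (fun x => c ^+ 2 * w x) by exact: integrable_itvZ.
rewrite RintegralD//; [|exact: integrable_itvD|exact: integrable_itvD].
do 2 (rewrite RintegralD//).
rewrite !RintegralZl// RintegralD//.
set X1 := int a b _; set X2 := int a b _; set X3 := int a b _; lra.
Qed.

Lemma H01_increment psi dpsi a b : H01 psi dpsi -> -1 <= a -> a <= b -> b <= 1 ->
  psi b = psi a + int a b dpsi.
Proof.
move=> [_ [di [_ [pE _]]]] a1 ab b1.
rewrite !pE ?a1 ?b1 ?(le_trans a1)// ?(le_trans ab)//.
rewrite (Rintegral_itv_cat a1 ab)//; exact: integrable_subitv di.
Qed.

Lemma H01_left psi dpsi : H01 psi dpsi -> psi (-1) = 0.
Proof.
move=> [_ [_ [_ [pE _]]]]; rewrite pE ?set_itv1 ?Rintegral_set1//.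
by rewrite lexx/=; lra.
Qed.

Lemma H01_int_split psi dpsi : H01 psi dpsi ->
  [/\ L2sq dpsi = int (-1) 0 (fun x => dpsi x ^+ 2) + int 0 1 (fun x => dpsi x ^+ 2),
      L2sq psi = int (-1) 0 (fun x => psi x ^+ 2) + int 0 1 (fun x => psi x ^+ 2)
    & itg (-1) 1 (fun x => psi x ^+ 2) ].
Proof.
move=> H; have [_ [di [d2i _]]] := H.
have n10 : (-1 : R) <= 0 by lra.
have n01 : (0 : R) <= 1 by lra.
have p2i : itg (-1) 1 (fun x => psi x ^+ 2).
  apply: integrable_itv_within.
  have pw : {within `[(-1), 1], continuous psi}.
    apply: (primitive_within_continuous _ di); first by lra.
    by move=> x x1 x2; apply: (H01_increment H).
  by move=> x; apply: cvgM; exact: pw.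
by split; rewrite // /L2sq (@Rintegral_itv_cat _ _ 0).
Qed.

(** On each half [ac_energy_ge] is applied to the extremal sinh (k (1 - |x|)), scaled to agree with
    psi at 0. The factor sinh k clears the denominator of 2 k coth k. *)
Lemma H01_energy_ge psi dpsi k : 0 < k -> H01 psi dpsi ->
  2 * k * ch k * psi 0 ^+ 2 <= sh k * (L2sq dpsi + k ^+ 2 * L2sq psi).
Proof.
move=> k0 H; have [_ [di [d2i _]]] := H; have [_ [_ [_ [_ p1]]]] := H.
have n10 : (-1 : R) <= 0 by lra.
have n01 : (0 : R) <= 1 by lra.
have sk := sh_gt0 k0.
pose c := psi 0 / sh k.
have L := @ac_energy_ge (-1) 0 dpsi psi (shs k 1) (fun x => k * chs k 1 x) k c n10.
have Rr := @ac_energy_ge 0 1 dpsi psi (shs k (-1)) (fun x => - k * chs k (-1) x) k c n01.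
have d1 e x : is_derive x 1 (shs k e) (k * e * chs k e x) := is_derive_shs k e x.
have d2 e x : is_derive x 1 (chs k e) (k * e * shs k e x) := is_derive_chs k e x.
have {}L := L (integrable_subitv (lexx _) n01 di) (integrable_subitv (lexx _) n01 d2i)
  (fun x u1 u2 => H01_increment H (lexx _) u1 (le_trans u2 n01)).
have {}Rr := Rr (integrable_subitv n10 (lexx _) di) (integrable_subitv n10 (lexx _) d2i)
  (fun x u1 u2 => H01_increment H n10 u1 u2).
have {}L := L _ _; have {}Rr := Rr _ _.
have {}L := L (fun x => ltac:(have h := d1 1 x; apply: (is_derive_eq h); ring)).
have {}L := L (fun x => ltac:(have h := d2 1 x; apply: is_derive_eq;
  rewrite /GRing.scale/=; ring)).
have {}Rr := Rr (fun x => ltac:(have h := d1 (-1) x; apply: (is_derive_eq h); ring)).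
have {}Rr := Rr (fun x => ltac:(have h := d2 (-1) x; apply: is_derive_eq;
  rewrite /GRing.scale/=; ring)).
have [-> -> _] := H01_int_split H.
move: L Rr.
set A1 := int _ _ _; set A2 := int _ _ _; set A3 := int _ _ _; set A4 := int _ _ _.
have eL : (1 : R) * -1 = -1 by ring.
have eR : (-1 : R) * 1 = -1 by ring.
rewrite p1 (H01_left H) !chs0 !shs0 (chs_end _ eL) (chs_end _ eR) (shs_end _ eL).
rewrite (shs_end _ eR) => L Rr.
have cs : c * sh k = psi 0 by rewrite /c mulfVK// gt_eqF.
rewrite -cs in L Rr *.
have -> : A1 + A3 + k ^+ 2 * (A2 + A4) = (A1 + k ^+ 2 * A2) + (A3 + k ^+ 2 * A4) by ring.
have := ler_wpM2l (ltW sk) (lerD L Rr).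
by apply: le_trans; rewrite le_eqVlt; apply/orP; left; apply/eqP; ring.
Qed.

(** Replacing coth k by 1 loses sharpness but leaves a coefficient linear in k, which can be tuned
    to absorb any given multiple of psi(0)^2. *)
Lemma H01_trace_le psi dpsi k : 0 < k -> H01 psi dpsi ->
  2 * k * psi 0 ^+ 2 <= L2sq dpsi + k ^+ 2 * L2sq psi.
Proof.
move=> k0 H; have sk := sh_gt0 k0.
rewrite -(ler_pM2l sk); apply: le_trans (H01_energy_ge k0 H).
have := ler_wpM2l (mulr_ge0 (ltW k0) (sqr_ge0 (psi 0))) (sh_le_ch k).
lra.
Qed.

(** Cauchy-Schwarz on [-1, x], whose length is at most 2. It serves to conclude psi = 0 once the
    norm of [dpsi] vanishes. *)
Lemma H01_sqr_le psi dpsi x : H01 psi dpsi -> -1 <= x -> x <= 1 ->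
  psi x ^+ 2 <= 2 * L2sq dpsi.
Proof.
move=> H x1 x2; have [_ [di [d2i _]]] := H.
have d2x := integrable_subitv (lexx _) x2 d2i.
rewrite (H01_increment H _ x1 x2) ?lexx// (H01_left H) add0r.
apply: le_trans (Rintegral_itv_CS x1 (integrable_subitv (lexx _) x2 di) d2x) _.
have p1 : 0 <= int (-1) x (fun x => dpsi x ^+ 2).
  by apply: Rintegral_ge0 => *; exact: sqr_ge0.
have p2 : 0 <= int x 1 (fun x => dpsi x ^+ 2).
  by apply: Rintegral_ge0 => *; exact: sqr_ge0.
rewrite /L2sq (Rintegral_itv_cat x1 x2)//.
apply: ler_pM => //; first by lra.
  by lra.
by rewrite lerDl.
Qed.

(** Cauchy-Schwarz on the two halves, each of length 1, from the zero at either wall. It bounds the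
    quotients defining [Bc2] by grho / 2. *)
Lemma H01_sqr0_le psi dpsi : H01 psi dpsi -> 2 * psi 0 ^+ 2 <= L2sq dpsi.
Proof.
move=> H; have [_ [di [d2i [_ p1]]]] := H.
have n10 : (-1 : R) <= 0 by lra.
have n01 : (0 : R) <= 1 by lra.
have [-> _ _] := H01_int_split H.
have := Rintegral_itv_CS n10 (integrable_subitv (lexx _) n01 di)
  (integrable_subitv (lexx _) n01 d2i).
have := Rintegral_itv_CS n01 (integrable_subitv n10 (lexx _) di)
  (integrable_subitv n10 (lexx _) d2i).
have e1 := H01_increment H (lexx _) n10 n01.
have e2 := H01_increment H n10 n01 (lexx _).
rewrite (H01_left H) add0r in e1; rewrite p1 in e2.
have -> : int 0 1 dpsi = - psi 0 by lra.
rewrite -e1 sqrrN subr0 opprK add0r !mul1r => h1 h2; lra.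
Qed.

Lemma L2sq_ge0 f : 0 <= L2sq f.
Proof. by apply: Rintegral_ge0 => *; exact: sqr_ge0. Qed.

Lemma L2sq_eq0_or_gt0 f : 0 = L2sq f \/ 0 < L2sq f.
Proof. by have := L2sq_ge0 f; rewrite le_eqVlt => /predU1P. Qed.

(** [Num.sqrt] is 0 on negative reals, so the case z < 0 is separate and trivial. *)
Lemma sqrt_le_norm (z t : R) : Num.sqrt z <= `|t| -> z <= t ^+ 2.
Proof.
move=> h; case: (leP 0 z) => z0; last by apply: le_trans (ltW z0) (sqr_ge0 _).
rewrite -(sqr_sqrtr z0) -[t ^+ 2]real_normK ?num_real//.
by rewrite ler_sqr// ?nnegrE ?sqrtr_ge0.
Qed.

Lemma magnetic_number_bound grho B psi dpsi : 0 < grho ->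
  Bc grho <= `|B| -> H01 psi dpsi ->
  grho * psi 0 ^+ 2 <= B ^+ 2 * L2sq dpsi.
Proof.
move=> g0 /sqrt_le_norm hB H.
have [|nz] := pselect (nonzero_on psi); last first.
  have -> : psi 0 = 0.
    apply/eqP; apply/negPn/negP => p0; apply: nz; exists 0; split => //.
    by apply/andP; split; lra.
  by rewrite expr0n mulr0 mulr_ge0 ?sqr_ge0 ?L2sq_ge0.
move=> nz; have [e|dp0] := L2sq_eq0_or_gt0 dpsi.
  case: nz => x [/andP[x1 x2] /negP []].
  have := H01_sqr_le H (ltW x1) (ltW x2); rewrite -e mulr0 => le0.
  by rewrite -sqrf_eq0; apply/eqP/le_anti; rewrite le0 sqr_ge0.
rewrite -ler_pdivrMr//; apply: le_trans hB.
apply: ub_le_sup; last by exists psi, dpsi.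
(* [sup] dominates its set only if the set is bounded above. A quotient with zero denominator is 0
   by convention and respects the bound too. *)
exists (grho / 2) => _ [p [q [Hp [nzp ->]]]].
have [<-|q0] := L2sq_eq0_or_gt0 q.
  by rewrite invr0 mulr0; lra.
rewrite ler_pdivrMr//.
have := ler_wpM2l (ltW g0) (H01_sqr0_le Hp); lra.
Qed.

Lemma critical_frequency_has_ubound grho B : 0 < grho -> B != 0 ->
  has_ubound [set r | exists psi dpsi, H01 psi dpsi /\ nonzero_on psi /\
    r = (grho * psi 0 ^+ 2 - B ^+ 2 * L2sq dpsi) / (B ^+ 2 * L2sq psi)].
Proof.
move=> g0 B0; have B2 : 0 < B ^+ 2 by rewrite exprn_even_gt0.
(* This k solves 2 k B^2 = grho: B^2 times the trace inequality then bounds the numerator by k^2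
   times the denominator. *)
pose k := grho / (2 * B ^+ 2).
have k0 : 0 < k by rewrite divr_gt0// mulr_gt0.
exists (k ^+ 2) => _ [p [q [Hp [_ ->]]]].
have [<-|p0] := L2sq_eq0_or_gt0 p.
  by rewrite mulr0 invr0 mulr0 sqr_ge0.
rewrite (ler_pdivrMr _ _ (mulr_gt0 B2 p0)).
have h := H01_trace_le k0 Hp.
have e : grho = 2 * k * B ^+ 2 by rewrite /k; field.
have := ler_wpM2r (ltW B2) h; rewrite e => {}h; lra.
Qed.

Lemma critical_frequency_bound grho B xi psi dpsi : 0 < grho -> B != 0 ->
  xihc grho B <= `|xi| -> H01 psi dpsi ->
  grho * psi 0 ^+ 2 <= B ^+ 2 * (xi ^+ 2 * L2sq psi + L2sq dpsi).
Proof.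
move=> g0 B0 /sqrt_le_norm hx H.
have B2 : 0 < B ^+ 2 by rewrite exprn_even_gt0.
(* If the norm of psi vanishes, its quotient is 0 by convention and carries no information; the
   trace inequality with 2 k B^2 = grho is used instead. *)
have [e|p0] := L2sq_eq0_or_gt0 psi.
  rewrite -e mulr0 add0r.
  pose k := grho / (2 * B ^+ 2).
  have k0 : 0 < k by rewrite divr_gt0// mulr_gt0.
  have := H01_trace_le k0 H; rewrite -e mulr0 addr0 => h.
  have e1 : grho = 2 * k * B ^+ 2 by rewrite /k; field.
  have := ler_wpM2l (ltW B2) h.
  rewrite {1}e1; lra.
have [|nz] := pselect (nonzero_on psi); last first.
  have -> : psi 0 = 0.
    apply/eqP; apply/negPn/negP => q0; apply: nz; exists 0; split => //.
    by apply/andP; split; lra.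
  rewrite expr0n mulr0 mulr_ge0 ?sqr_ge0// addr_ge0 ?L2sq_ge0//.
  by rewrite mulr_ge0 ?sqr_ge0 ?L2sq_ge0.
move=> nz.
have : (grho * psi 0 ^+ 2 - B ^+ 2 * L2sq dpsi) / (B ^+ 2 * L2sq psi) <= xi ^+ 2.
  apply: le_trans hx; apply: ub_le_sup; last by exists psi, dpsi.
  exact: critical_frequency_has_ubound.
rewrite (ler_pdivrMr _ _ (mulr_gt0 B2 p0)) => h; lra.
Qed.

(** Since xi^2 lies strictly below the supremum, some test function has a quotient above xi^2. The
    sharp inequality [H01_energy_ge] and cancellation of psi(0)^2 turn this into a closed-form
    condition. *)
Lemma lt_critical_frequency grho B xi : B != 0 -> 0 < xi ->
  xi < xihc grho B -> B ^+ 2 * (2 * xi * ch xi) < grho * sh xi.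
Proof.
move=> B0 xi0; have B2 : 0 < B ^+ 2 by rewrite exprn_even_gt0.
rewrite /xihc => hx.
have x2 : 0 < xihc2 grho B.
  by rewrite -sqrtr_gt0; apply: lt_trans hx.
have lt2 : xi ^+ 2 < xihc2 grho B.
  rewrite -(sqr_sqrtr (ltW x2)) ltr_sqr// ?nnegrE ?sqrtr_ge0//; exact: ltW.
have sx : sh xi > 0 by exact: sh_gt0.
move: lt2; rewrite /xihc2; set E := (X in sup X) => lt2.
have E0 : E !=set0.
  (* The supremum of the empty set is 0 by convention, which cannot exceed xi^2. *)
  apply/set0P/eqP => e; move: lt2; rewrite e sup0 => h.
  by have := sqr_ge0 xi; rewrite leNgt h.
have [_ [p [q [Hp [_ ->]]]]] := sup_gt E0 lt2.
have [<-|p0] := L2sq_eq0_or_gt0 p.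
  by rewrite mulr0 invr0 mulr0 ltNge sqr_ge0.
rewrite (ltr_pdivlMr _ _ (mulr_gt0 B2 p0)) => lt.
have {lt}: B ^+ 2 * (L2sq q + xi ^+ 2 * L2sq p) < grho * p 0 ^+ 2 by lra.
rewrite -(ltr_pM2l sx) => lt.
have := ler_wpM2l (ltW B2) (H01_energy_ge xi0 Hp) => le.
have {lt le}: B ^+ 2 * (2 * xi * ch xi) * p 0 ^+ 2 < grho * sh xi * p 0 ^+ 2.
  lra.
have := sqr_ge0 (p 0); rewrite le_eqVlt => /predU1P[<-|pp]; first by rewrite !mulr0 ltxx.
by rewrite ltr_pM2r.
Qed.

End Sobolev.

(** * The energy inequality *)

Section Extension.
Variable R : realType.
Implicit Types (a b c l x y : R) (f g h : R -> R).

Lemma continuous_glue c l f g h x :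
  (forall y, y < c -> h y = f y) -> (forall y, c < y -> h y = g y) -> h c = l ->
  (x < c -> {for x, continuous f}) -> (c < x -> {for x, continuous g}) ->
  f @ c^'- --> l -> g @ c^'+ --> l -> {for x, continuous h}.
Proof.
move=> hf hg hc cf cg fl gl; case: (ltgtP x c) => [xc|cx|->].
- rewrite /prop_for /continuous_at (hf _ xc).
  apply: cvg_trans (cf xc); apply: near_eq_cvg.
  by near=> y; rewrite hf//; near: y; exact: lt_nbhsl.
- rewrite /prop_for /continuous_at (hg _ cx).
  apply: cvg_trans (cg cx); apply: near_eq_cvg.
  by near=> y; rewrite hg//; near: y; exact: lt_nbhsr.
- apply/left_right_continuousP; rewrite hc; split.
  + apply: cvg_trans fl; apply: near_eq_cvg.
    by near=> y; rewrite hf//; near: y; exact: nbhs_left_lt.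
  + apply: cvg_trans gl; apply: near_eq_cvg.
    by near=> y; rewrite hg//; near: y; exact: nbhs_right_gt.
Unshelve. all: by end_near. Qed.

(** Continuing by constants beyond the ends makes the derivatives of a C^4 piece continuous on the
    whole line, with the one-sided limits as values at the ends. *)
Definition ext f a b x : R :=
  if x <= a then rlim f a else if x < b then f x else llim f b.

Lemma ext_in f a b x : a < x -> x < b -> ext f a b x = f x.
Proof. by move=> ax xb; rewrite /ext leNgt ax xb. Qed.

Lemma ext_left f a b : ext f a b a = rlim f a.
Proof. by rewrite /ext lexx. Qed.

Lemma ext_right f a b : a < b -> ext f a b b = llim f b.
Proof. by move=> ab; rewrite /ext leNgt ab ltxx. Qed.

Lemma continuous_ext f a b : a < b ->
  (forall x, a < x -> x < b -> {for x, continuous f}) ->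
  cvg (f @ a^'+) -> cvg (f @ b^'-) -> continuous (ext f a b).
Proof.
move=> ab fc fa fb x.
pose h y := if y < b then f y else llim f b.
have hfa : h @ a^'+ --> rlim f a.
  apply: cvg_trans fa; apply: near_eq_cvg.
  by near=> y; rewrite /h ifT//; near: y; exact: nbhs_right_lt.
apply: (@continuous_glue a (rlim f a) (fun=> rlim f a) h).
- by move=> y ya; rewrite /ext ltW.
- by move=> y ay; rewrite /ext leNgt ay.
- exact: ext_left.
- by move=> _; exact: cvg_cst.
- move=> ax; apply: (@continuous_glue b (llim f b) f (fun=> llim f b)).
  + by move=> y yb; rewrite /h yb.
  + by move=> y yb; rewrite /h ltNge ltW.
  + by rewrite /h ltxx.
  + by move=> xb; exact: fc.
  + by move=> _; exact: cvg_cst.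
  + exact: fb.
  + exact: cvg_cst.
- exact: cvg_cst.
- exact: hfa.
Unshelve. all: by end_near. Qed.

Section ClosedInterval.
Variables (f : R -> R) (a b : R).
Hypotheses (ab : a < b) (Cf : Ck_closed 4 f a b).
Let P n := ext (derive1n n f) a b.

Lemma Ck_ext_continuous n : (n <= 4)%N -> continuous (P n).
Proof.
case: Cf => [df [c4 [lims _]]] n4; have [la lb] := lims n n4.
apply: (continuous_ext ab _ la lb) => x ax xb.
move: n4; rewrite leq_eqVlt => /predU1P[->|n4]; first by apply: c4; rewrite ax.
apply: differentiable_continuous; apply/derivable1_diffP.
by apply: df => //; rewrite ax.
Qed.

Lemma Ck_ext_derive n x : (n < 4)%N -> a < x -> x < b ->
  is_derive x 1 (P n) (P n.+1 x).
Proof.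
case: Cf => [df _] n4 ax xb.
apply: (@near_eq_is_derive _ _ _ (derive1n n f)).
  near=> y; rewrite /P ext_in; first by [].
    by near: y; exact: lt_nbhsr.
  by near: y; exact: lt_nbhsl.
rewrite /P (ext_in _ ax xb).
have d : derivable (derive1n n f) x 1 by apply: (df _ n4); rewrite ax.
by apply: (DeriveDef d); rewrite -derive1E.
Unshelve. all: by end_near. Qed.

Lemma Ck_ext0 x : a <= x -> x <= b -> P 0 x = f x.
Proof.
case: Cf => [_ [_ [_ [fa fb]]]].
rewrite le_eqVlt => /predU1P[<- _|ax]; first by rewrite /P ext_left fa.
rewrite le_eqVlt => /predU1P[->|xb]; first by rewrite /P ext_right.
by rewrite /P ext_in.
Qed.

End ClosedInterval.
End Extension.

(** * Energy flux and its jump at the interface *)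

Section Energy.
Variable R : realType.
Implicit Types (a b c x y rho r mu B xi lam : R) (psi dpsi : R -> R).
Local Notation leb := (@lebesgue_measure R).
Local Notation int a b f := (Rintegral leb `[a, b] f).

Definition energy_flux rho mu B xi lam (d0 d1 d2 d3 : R) : R :=
  lam ^+ 2 * rho * (d0 * d1)
  + mu * lam * (4 * xi ^+ 2 * (d0 * d1) - d0 * d3 + d1 * d2)
  + B ^+ 2 * xi ^+ 2 * (d0 * d1).

(* The flux is a primitive of the density
   lam^2 rho (xi^2 psi^2 + psi'^2) + mu lam ((xi^2 psi + psi'')^2 + 4 xi^2 psi'^2)
     + B^2 xi^2 (xi^2 psi^2 + psi'^2). *)
Lemma energy_flux_ge rho r mu B xi lam a b (P : nat -> R -> R) : a <= b ->
  0 <= r -> r <= rho -> 0 <= mu -> 0 <= lam ->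
  (forall n, (n <= 3)%N -> continuous (P n)) ->
  (forall n x, (n < 4)%N -> a < x -> x < b -> is_derive x 1 (P n) (P n.+1 x)) ->
  (forall x, a < x -> x < b ->
    - (lam ^+ 2 * rho * (xi ^+ 2 * P 0%N x - P 2%N x)) =
    mu * lam * (xi ^+ 4 * P 0%N x - 2 * xi ^+ 2 * P 2%N x + P 4%N x)
    + B ^+ 2 * (xi ^+ 4 * P 0%N x - xi ^+ 2 * P 2%N x)) ->
  (lam ^+ 2 * r + B ^+ 2 * xi ^+ 2) * int a b (fun x => P 1%N x ^+ 2)
    + B ^+ 2 * xi ^+ 4 * int a b (fun x => P 0%N x ^+ 2) <=
  energy_flux rho mu B xi lam (P 0%N b) (P 1%N b) (P 2%N b) (P 3%N b)
  - energy_flux rho mu B xi lam (P 0%N a) (P 1%N a) (P 2%N a) (P 3%N a).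
Proof.
move=> ab r0 rr mu0 lam0 cP dP ode.
pose J x := energy_flux rho mu B xi lam (P 0%N x) (P 1%N x) (P 2%N x) (P 3%N x).
pose e x := lam ^+ 2 * rho * (xi ^+ 2 * (P 0%N x * P 0%N x) + P 1%N x * P 1%N x)
  + mu * lam * ((xi ^+ 2 * P 0%N x + P 2%N x) * (xi ^+ 2 * P 0%N x + P 2%N x)
       + 4 * xi ^+ 2 * (P 1%N x * P 1%N x))
  + B ^+ 2 * xi ^+ 2 * (xi ^+ 2 * (P 0%N x * P 0%N x) + P 1%N x * P 1%N x).
have c0 := cP 0%N isT; have c1 := cP 1%N isT; have c2 := cP 2%N isT; have c3 := cP 3%N isT.
have cJ : continuous J.
  rewrite /J /energy_flux.
  by continuity_real.
have ce : continuous e.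
  rewrite /e.
  by continuity_real.
rewrite -[X in _ <= X]/(J b - J a).
have <- : int a b e = J b - J a.
  apply: (Rintegral_itv_FTC2 ab cJ ce) => x ax xb.
  have d0 := dP 0%N x isT ax xb; have d1 := dP 1%N x isT ax xb.
  have d2 := dP 2%N x isT ax xb; have d3 := dP 3%N x isT ax xb.
  have od := ode x ax xb.
  rewrite /J /energy_flux.
  apply: is_derive_eq; rewrite /GRing.scale/= /e.
  apply/eqP; rewrite -subr_eq0; apply/eqP.
  (* The derivative of the flux differs from the density by psi times the residual of the
     equation. *)
  transitivity (P 0%N x * (- (lam ^+ 2 * rho * (xi ^+ 2 * P 0%N x - P 2%N x)) -
    (mu * lam * (xi ^+ 4 * P 0%N x - 2 * xi ^+ 2 * P 2%N x + P 4%N x)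
    + B ^+ 2 * (xi ^+ 4 * P 0%N x - xi ^+ 2 * P 2%N x)))); first by ring.
  by rewrite od subrr mulr0.
have i1 : leb.-integrable `[a, b] (EFin \o (fun x => P 1%N x ^+ 2)).
  by apply: integrable_itv_cts; exact: continuous_realM.
have i0 : leb.-integrable `[a, b] (EFin \o (fun x => P 0%N x ^+ 2)).
  by apply: integrable_itv_cts; exact: continuous_realM.
rewrite -!RintegralZl// -RintegralD//; [|exact: integrable_itvZ|exact: integrable_itvZ].
apply: le_Rintegral => //.
- by apply: integrable_itvD; exact: integrable_itvZ.
- exact: integrable_itv_cts.
move=> x _; rewrite -subr_ge0.
(* What is dropped is a combination of squares with nonnegative weights. Lowering rho to r gives
   both sides of the interface the same constant. *)
rewrite (_ : _ - _ = lam ^+ 2 * rho * (xi * P 0%N x) ^+ 2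
  + lam ^+ 2 * (rho - r) * P 1%N x ^+ 2
  + mu * lam * ((xi ^+ 2 * P 0%N x + P 2%N x) ^+ 2 + (2 * xi * P 1%N x) ^+ 2)); last first.
  by rewrite /e; ring.
have rho0 := le_trans r0 rr.
apply: addr_ge0; first apply: addr_ge0.
- exact: mulr_ge0 (mulr_ge0 (sqr_ge0 _) rho0) (sqr_ge0 _).
- by apply: mulr_ge0 (mulr_ge0 (sqr_ge0 _) _) (sqr_ge0 _); rewrite subr_ge0.
- exact: mulr_ge0 (mulr_ge0 mu0 lam0) (addr_ge0 (sqr_ge0 _) (sqr_ge0 _)).
Qed.

(** The fourth jump condition solved for its gravity term; in the energy balance this is the factor
    multiplying psi(0). *)
Definition force_jump rhop rhom mup mum xi lam psi : R :=
  let dp n := rlim (derive1n n psi) 0 in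
  let dm n := llim (derive1n n psi) 0 in
  mup * lam * (dp 3%N - 3 * xi ^+ 2 * dp 1%N)
    - mum * lam * (dm 3%N - 3 * xi ^+ 2 * dm 1%N)
    - (lam ^+ 2 * rhop * dp 1%N - lam ^+ 2 * rhom * dm 1%N).

(* The problem without the fourth jump condition; [[psi]] = 0 is implied by [Ck_closed]. *)
Definition quasi_solution rhop rhom mup mum B xi lam psi : Prop :=
  let dp n := rlim (derive1n n psi) 0 in
  let dm n := llim (derive1n n psi) 0 in
  Ck_closed 4 psi (-1) 0 /\ Ck_closed 4 psi 0 1 /\
  (forall x, 0 < x < 1 -> ode_at rhop mup B xi lam psi x) /\
  (forall x, -1 < x < 0 -> ode_at rhom mum B xi lam psi x) /\
  dp 1%N = dm 1%N /\
  mup * lam * (xi ^+ 2 * dp 0%N + dp 2%N) - mum * lam * (xi ^+ 2 * dm 0%N + dm 2%N) = 0 /\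
  psi (-1) = 0 /\ psi 1 = 0 /\
  rlim (derive1n 1 psi) (-1) = 0 /\ llim (derive1n 1 psi) 1 = 0.

Lemma is_solutionP g rhop rhom mup mum B xi lam psi :
  is_solution g rhop rhom mup mum B xi lam psi <->
  quasi_solution rhop rhom mup mum B xi lam psi /\
  force_jump rhop rhom mup mum xi lam psi = g * (rhop - rhom) * xi ^+ 2 * psi 0.
Proof.
split.
  move=> [C1 [C2 [w1 [w2 [j0 [j1 [j2 [j3 [b1 [b2 [b3 b4]]]]]]]]]]].
  split; last by rewrite /force_jump j3 addrAC subrr add0r.
  refine (conj C1 (conj C2 (conj w1 (conj w2
    (conj _ (conj j2 (conj b1 (conj b2 (conj b3 b4))))))))).
  by apply/eqP; rewrite -subr_eq0; apply/eqP.
move=> [[C1 [C2 [w1 [w2 [j1 [j2 [b1 [b2 [b3 b4]]]]]]]]] j3].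
have e1 : rlim psi 0 = psi 0 by case: C2 => [_ [_ [_ [->]]]].
have e2 : llim psi 0 = psi 0 by case: C1 => [_ [_ [_ [_ ->]]]].
refine (conj C1 (conj C2 (conj w1 (conj w2 (conj _
  (conj _ (conj j2 (conj _ (conj b1 (conj b2 (conj b3 b4))))))))))).
- by rewrite e1 e2 subrr.
- by apply/eqP; rewrite subr_eq0; apply/eqP.
- rewrite -j3 /force_jump; move: (rlim _ 0) (rlim _ 0) (llim _ 0) (llim _ 0) => *; ring.
Qed.

(** The flux increments over the two halves are added. At the walls the flux vanishes with psi and
    psi'; at 0 its jump is psi(0) times [force_jump], up to psi'(0) times the third jump, which is
    zero. *)
Lemma quasi_solution_energy rhop rhom mup mum B xi lam psi :
  0 <= rhom -> rhom <= rhop -> 0 <= mup -> 0 <= mum -> 0 <= lam ->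
  quasi_solution rhop rhom mup mum B xi lam psi ->
  exists dpsi, H01 psi dpsi /\
    lam ^+ 2 * rhom * L2sq dpsi
      + B ^+ 2 * xi ^+ 2 * (xi ^+ 2 * L2sq psi + L2sq dpsi) <=
    psi 0 * force_jump rhop rhom mup mum xi lam psi.
Proof.
have n10 : (-1 : R) < 0 by lra.
have n01 : (0 : R) < 1 by lra.
move=> rm0 rmp mp0 mm0 lam0 [C1 [C2 [w1 [w2 [j1 [j2 [b1 [b2 [b3 b4]]]]]]]]].
pose M n := ext (derive1n n psi) (-1) 0.
pose P n := ext (derive1n n psi) 0 1.
have M0 x : -1 <= x -> x <= 0 -> M 0%N x = psi x by move=> *; exact: (Ck_ext0 n10 C1).
have P0 x : 0 <= x -> x <= 1 -> P 0%N x = psi x by move=> *; exact: (Ck_ext0 n01 C2).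
have cM n : (n <= 4)%N -> continuous (M n) by exact: (Ck_ext_continuous n10 C1).
have cP n : (n <= 4)%N -> continuous (P n) by exact: (Ck_ext_continuous n01 C2).
have dM n x : (n < 4)%N -> -1 < x -> x < 0 -> is_derive x 1 (M n) (M n.+1 x).
  exact: (Ck_ext_derive C1).
have dP n x : (n < 4)%N -> 0 < x -> x < 1 -> is_derive x 1 (P n) (P n.+1 x).
  exact: (Ck_ext_derive C2).
(* The weak derivative glues the two one-sided derivatives; they match at 0, so [q] is
   continuous. *)
pose q x := if x <= 0 then M 1%N x else P 1%N x.
have qM x : x <= 0 -> q x = M 1%N x by rewrite /q => ->.
have j1' : M 1%N 0 = P 1%N 0 by rewrite /M /P ext_right// ext_left.
have qP x : 0 <= x -> q x = P 1%N x.
  rewrite le_eqVlt => /predU1P[<-|x0]; first by rewrite qM.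
  by rewrite /q leNgt x0.
have cq : continuous q.
  move=> x; apply: (@continuous_glue _ 0 (M 1%N 0) (M 1%N) (P 1%N)).
  - by move=> y /ltW; exact: qM.
  - by move=> y /ltW; exact: qP.
  - exact: qM.
  - by move=> _; exact: cM.
  - by move=> _; exact: cP.
  - by apply: cvg_at_left_filter; exact: cM.
  - by rewrite j1'; apply: cvg_at_right_filter; exact: cP.
have intL x : -1 <= x -> x <= 0 -> int (-1) x q = psi x.
  move=> x1 x2; have -> : int (-1) x q = int (-1) x (M 1%N).
    by apply: eq_Rintegral_itv => y _ yx; exact: qM (le_trans yx x2).
  have -> : int (-1) x (M 1%N) = M 0%N x - M 0%N (-1).
    apply: (Rintegral_itv_FTC2 x1 (cM 0%N isT) (cM 1%N isT)) => y y1 y2.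
    exact: (dM 0%N y isT y1 (lt_le_trans y2 x2)).
  by rewrite !M0 ?b1 ?subr0// ltW.
have intR x : 0 <= x -> x <= 1 -> int 0 x q = psi x - psi 0.
  move=> x1 x2; have -> : int 0 x q = int 0 x (P 1%N).
    by apply: eq_Rintegral_itv => y y0 _; exact: qP.
  have -> : int 0 x (P 1%N) = P 0%N x - P 0%N 0.
    apply: (Rintegral_itv_FTC2 x1 (cP 0%N isT) (cP 1%N isT)) => y y1 y2.
    exact: (dP 0%N y isT y1 (lt_le_trans y2 x2)).
  by rewrite !P0// ltW.
have qi a b : leb.-integrable `[a, b] (EFin \o q) by exact: integrable_itv_cts.
have q2i a b : leb.-integrable `[a, b] (EFin \o (fun x => q x ^+ 2)).
  by apply: integrable_itv_cts => x; apply: cvgM; exact: cq.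
have H : H01 psi q.
  split; first by apply: measurable_funTS; exact: continuous_measurable_fun.
  do 2 (split; first by []).
  split => // x /andP[x1 x2]; case: (leP x 0) => x0; first by rewrite intL.
  rewrite (Rintegral_itv_cat (ltW n10) (ltW x0) (qi _ _)).
  by rewrite (intL _ (ltW n10) (lexx _)) (intR _ (ltW x0) x2); ring.
exists q; split => //.
have [-> -> _] := H01_int_split H.
have MI n x : -1 < x -> x < 0 -> M n x = derive1n n psi x by exact: ext_in.
have PI n x : 0 < x -> x < 1 -> P n x = derive1n n psi x by exact: ext_in.
have L := @energy_flux_ge rhom rhom mum B xi lam (-1) 0 M (ltW n10) rm0 (lexx _)
  mm0 lam0 (fun n hn => cM n (leq_trans hn (leqnSn 3))) dM.
have Rr := @energy_flux_ge rhop rhom mup B xi lam 0 1 P (ltW n01) rm0 rmp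
  mp0 lam0 (fun n hn => cP n (leq_trans hn (leqnSn 3))) dP.
have odeM x : -1 < x -> x < 0 ->
    - (lam ^+ 2 * rhom * (xi ^+ 2 * M 0%N x - M 2%N x)) =
    mum * lam * (xi ^+ 4 * M 0%N x - 2 * xi ^+ 2 * M 2%N x + M 4%N x)
    + B ^+ 2 * (xi ^+ 4 * M 0%N x - xi ^+ 2 * M 2%N x).
  move=> u v; rewrite (MI 0%N _ u v) (MI 2%N _ u v) (MI 4%N _ u v).
  by apply: w2; rewrite u v.
have odeP x : 0 < x -> x < 1 ->
    - (lam ^+ 2 * rhop * (xi ^+ 2 * P 0%N x - P 2%N x)) =
    mup * lam * (xi ^+ 4 * P 0%N x - 2 * xi ^+ 2 * P 2%N x + P 4%N x)
    + B ^+ 2 * (xi ^+ 4 * P 0%N x - xi ^+ 2 * P 2%N x).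
  move=> u v; rewrite (PI 0%N _ u v) (PI 2%N _ u v) (PI 4%N _ u v).
  by apply: w1; rewrite u v.
have {odeM}L := L odeM; have {odeP}Rr := Rr odeP.
have -> : int (-1) 0 (fun x => q x ^+ 2) = int (-1) 0 (fun x => M 1%N x ^+ 2).
  by apply: eq_Rintegral_itv => y _ y0; rewrite qM.
have -> : int 0 1 (fun x => q x ^+ 2) = int 0 1 (fun x => P 1%N x ^+ 2).
  by apply: eq_Rintegral_itv => y y0 _; rewrite qP.
have -> : int (-1) 0 (fun x => psi x ^+ 2) = int (-1) 0 (fun x => M 0%N x ^+ 2).
  by apply: eq_Rintegral_itv => y y1 y2; rewrite M0.
have -> : int 0 1 (fun x => psi x ^+ 2) = int 0 1 (fun x => P 0%N x ^+ 2).
  by apply: eq_Rintegral_itv => y y1 y2; rewrite P0.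
have M00 : M 0%N 0 = psi 0 by apply: M0 => //; exact: ltW.
have P00 : P 0%N 0 = psi 0 by apply: P0 => //; exact: ltW.
have M0l : M 0%N (-1) = 0 by rewrite M0// ltW.
have P0r : P 0%N 1 = 0 by rewrite P0// ltW.
have M1l : M 1%N (-1) = 0 by rewrite /M ext_left.
have P1r : P 1%N 1 = 0 by rewrite /P (ext_right _ n01).
have Mn n : llim (derive1n n psi) 0 = M n 0 by rewrite /M (ext_right _ n10).
have Pn n : rlim (derive1n n psi) 0 = P n 0 by rewrite /P ext_left.
rewrite /force_jump !Mn !Pn.
(* The third jump condition times psi'(0) is the cross term in the flux jump, prepared for linear
   arithmetic. *)
have j2' : P 1%N 0 * (mup * lam * (xi ^+ 2 * psi 0 + P 2%N 0)
    - mum * lam * (xi ^+ 2 * psi 0 + M 2%N 0)) = 0.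
  by move: j2; rewrite !Pn !Mn P00 M00 => ->; rewrite mulr0.
move: L Rr j2'; rewrite /energy_flux M00 P00 M0l P0r M1l P1r j1'.
move: (int _ _ _) (int _ _ _) (int _ _ _) (int _ _ _) (psi 0).
move: (P 1%N 0) (P 2%N 0) (P 3%N 0) (M 2%N 0) (M 3%N 0) (M 2%N (-1)) (M 3%N (-1)).
move: (P 2%N 1) (P 3%N 1); clear => *; lra.
Qed.

End Energy.

(** * Explicit solutions *)

Section SmoothPieces.
Variable R : realType.
Implicit Types (a b x y : R) (f g : R -> R).

Lemma eq_derive1n_oo f g a b n : (forall x, a < x -> x < b -> f x = g x) ->
  forall x, a < x -> x < b -> derive1n n f x = derive1n n g x.
Proof.
move=> fg; elim: n => [|n IH] x ax xb; first exact: fg.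
rewrite [LHS]/= [RHS]/= !derive1E; apply: near_eq_derive.
near=> y; apply: IH; near: y; [exact: lt_nbhsr|exact: lt_nbhsl].
Unshelve. all: by end_near. Qed.

Variables (f g : R -> R) (a b : R).
Hypotheses (ab : a < b) (fg : forall x, a <= x -> x <= b -> f x = g x).
Hypothesis dg : forall n x, derivable (derive1n n g) x 1.

Let fg_oo n x : a < x -> x < b -> derive1n n f x = derive1n n g x.
Proof. by apply: eq_derive1n_oo => y ay yb; apply: fg; exact: ltW. Qed.

Let cg n : continuous (derive1n n g).
Proof.
by move=> x; apply: differentiable_continuous; apply/derivable1_diffP; exact: dg.
Qed.

Lemma smooth_piece_open : smooth_open f a b.
Proof.
move=> n x /andP[ax xb]; apply: (@near_eq_derivable _ _ _ (derive1n n g)); last exact: dg.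
near=> y; apply/esym/fg_oo; near: y; [exact: lt_nbhsr|exact: lt_nbhsl].
Unshelve. all: by end_near. Qed.

Lemma smooth_piece_cvg_right n : derive1n n f @ a^'+ --> derive1n n g a.
Proof.
have : derive1n n g @ a^'+ --> derive1n n g a by apply: cvg_at_right_filter; exact: cg.
apply: cvg_trans; apply: near_eq_cvg.
near=> y; apply/esym/fg_oo; near: y; [exact: nbhs_right_gt|exact: nbhs_right_lt].
Unshelve. all: by end_near. Qed.

Lemma smooth_piece_cvg_left n : derive1n n f @ b^'- --> derive1n n g b.
Proof.
have : derive1n n g @ b^'- --> derive1n n g b by apply: cvg_at_left_filter; exact: cg.
apply: cvg_trans; apply: near_eq_cvg.
near=> y; apply/esym/fg_oo; near: y; [exact: nbhs_left_gt|exact: nbhs_left_lt].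
Unshelve. all: by end_near. Qed.

Lemma smooth_piece_rlim n : rlim (derive1n n f) a = derive1n n g a.
Proof. by apply: cvg_lim => //; exact: smooth_piece_cvg_right. Qed.

Lemma smooth_piece_llim n : llim (derive1n n f) b = derive1n n g b.
Proof. by apply: cvg_lim => //; exact: smooth_piece_cvg_left. Qed.

(** On [a, b] the function agrees with [g], smooth on the whole line, so all one-sided limits are
    values of derivatives of [g]. *)
Lemma smooth_piece_Ck k : Ck_closed k f a b.
Proof.
split; first by move=> n _ x xab; exact: smooth_piece_open.
split.
  move=> x xab; apply: differentiable_continuous; apply/derivable1_diffP.
  exact: smooth_piece_open.
split.
  move=> n _; split; apply/cvg_ex.
    by exists (derive1n n g a); exact: smooth_piece_cvg_right.
  by exists (derive1n n g b); exact: smooth_piece_cvg_left.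
split.
  by rewrite -[f]/(derive1n 0 f) smooth_piece_rlim /= fg// ltW.
by rewrite -[f]/(derive1n 0 f) smooth_piece_llim /= fg// ltW.
Qed.

End SmoothPieces.

(** * Combinations of hyperbolic functions with two rates *)

Section HyperbolicModes.
Variable R : realType.
Implicit Types (s k e x : R) (A : R * R * R * R).

Definition mode s k e A x : R :=
  let: (a1, a2, a3, a4) := A in
  a1 * chs s e x + a2 * shs s e x + (a3 * chs k e x + a4 * shs k e x).

(** Differentiation acts linearly on the coefficients, so higher derivatives reduce to iterating a
    map on four numbers. *)
Definition mode_step s k e A : R * R * R * R :=
  let: (a1, a2, a3, a4) := A in
  (s * e * a2, s * e * a1, k * e * a4, k * e * a3).

Lemma is_derive_mode s k e A x :
  is_derive x 1 (mode s k e A) (mode s k e (mode_step s k e A) x).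
Proof.
case: A => [[[a1 a2] a3] a4]; rewrite /mode /mode_step.
have h1 := is_derive_chs s e x; have h2 := is_derive_shs s e x.
have h3 := is_derive_chs k e x; have h4 := is_derive_shs k e x.
by apply: is_derive_eq; rewrite /GRing.scale/=; ring.
Qed.

Lemma derive1n_mode s k e A n :
  derive1n n (mode s k e A) = mode s k e (iter n (mode_step s k e) A).
Proof.
elim: n => // n IH; rewrite [LHS]/= -/(derive1n n _) IH; apply/funext => x.
have h := is_derive_mode s k e (iter n (mode_step s k e) A) x.
by rewrite derive1E; exact: derive_val.
Qed.

Lemma derivable_mode s k e A n x : derivable (derive1n n (mode s k e A)) x 1.
Proof.
by rewrite derive1n_mode; have [] := is_derive_mode s k e (iter n (mode_step s k e) A) x.
Qed.

End HyperbolicModes.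

(** * Solutions clamped at the wall and their interface stiffness *)

Section Clamped.
Variable R : realType.
Implicit Types (s k e x a b th : R).

(* Values at t = 1 of S(t) = sinh(s t)/s - sinh(k t)/k, which vanishes to second order
   at t = 0, and of its first four derivatives. *)
Definition clS s k : R := sh s / s - sh k / k.
Definition clC s k : R := ch s - ch k.
Definition clC1 s k : R := s * sh s - k * sh k.
Definition clC2 s k : R := s ^+ 2 * ch s - k ^+ 2 * ch k.
Definition clC3 s k : R := s ^+ 3 * sh s - k ^+ 3 * sh k.
(** The Wronskian at t = 1 of the two clamped solutions S' and S, that is S'^2 - S S''. *)
Definition clD s k : R := clC s k ^+ 2 - clS s k * clC1 s k.

(** The [stiff] coefficients express psi''(0) and psi'''(0) through psi(0) and psi'(0) for a clamped
    solution; see [clamped2] and [clamped3]. *)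
Definition stiff01 s k : R := (clC s k * clC2 s k - clC1 s k ^+ 2) / clD s k.
Definition stiff11 s k : R := (clC s k * clC1 s k - clS s k * clC2 s k) / clD s k.
Definition stiff00 s k : R := (clC1 s k * clC2 s k - clC s k * clC3 s k) / clD s k.

Lemma ltr_sqr_ge0 x a : 0 <= x -> x < a -> x ^+ 2 < a ^+ 2.
Proof. by move=> x0 xa; rewrite ltr_sqr ?nnegrE// (le_trans x0)// ltW. Qed.

Lemma clDE s k : s != 0 -> k != 0 ->
  clD s k = 2 - 2 * ch s * ch k + (k / s + s / k) * sh s * sh k.
Proof.
move=> s0 k0.
transitivity ((ch s ^+ 2 - sh s ^+ 2) + (ch k ^+ 2 - sh k ^+ 2)
   - 2 * ch s * ch k + (k / s + s / k) * sh s * sh k); last by rewrite !ch2_sub_sh2.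
rewrite /clD /clC /clS /clC1; field.
by rewrite s0 k0.
Qed.

(* With half sum y and half difference d the claim reads (d sinh y)^2 > (y sinh d)^2. *)
Lemma clD_gt0 s k : 0 < k -> k < s -> 0 < clD s k.
Proof.
move=> k0 ks; have s0 := lt_trans k0 ks.
rewrite clDE ?gt_eqF//.
pose y := (s + k) / 2; pose d := (s - k) / 2.
have d0 : 0 < d by rewrite /d; lra.
have dy : d < y by rewrite /d /y; lra.
have sE : s = y + d by rewrite /y /d; field.
have kE : k = y + - d by rewrite /y /d; field.
have h := sh_ratio_lt d0 dy.
have q : (y * sh d) ^+ 2 < (d * sh y) ^+ 2.
  apply: ltr_sqr_ge0 h; apply: mulr_ge0; first by lra.
  exact/ltW/sh_gt0.
have sk0 : 0 < s * k by exact: mulr_gt0.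
rewrite -(pmulr_rgt0 _ sk0).
have -> : s * k * (2 - 2 * ch s * ch k + (k / s + s / k) * sh s * sh k) =
   s * k * (2 - 2 * (ch s * ch k)) + (k ^+ 2 + s ^+ 2) * (sh s * sh k).
  by field; rewrite !gt_eqF.
have cc : ch s * ch k = ch y ^+ 2 * ch d ^+ 2 - sh y ^+ 2 * sh d ^+ 2.
  by rewrite sE kE !chD chN shN; ring.
have ss : sh s * sh k = sh y ^+ 2 * ch d ^+ 2 - ch y ^+ 2 * sh d ^+ 2.
  by rewrite sE kE !shD chN shN; ring.
have e1 : ch y ^+ 2 = 1 + sh y ^+ 2 by have := ch2_sub_sh2 y; lra.
have e2 : ch d ^+ 2 = 1 + sh d ^+ 2 by have := ch2_sub_sh2 d; lra.
rewrite cc ss e1 e2 sE kE; clearbody y d.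
rewrite (_ : _ + _ = 4 * ((d * sh y) ^+ 2 - (y * sh d) ^+ 2)); first by lra.
ring.
Qed.

(** By the addition formulas the numerator is a positive multiple of (s - k) sinh (s + k) - (s + k)
    sinh (s - k), positive by [sh_ratio_lt]. *)
Lemma stiff11_gt0 s k : 0 < k -> k < s -> 0 < stiff11 s k.
Proof.
move=> k0 ks; have s0 := lt_trans k0 ks.
rewrite divr_gt0 ?clD_gt0//.
have -> : clC s k * clC1 s k - clS s k * clC2 s k =
   (s ^+ 2 - k ^+ 2) / (2 * s * k) *
   ((s - k) * sh (s + k) - (s + k) * sh (s - k)).
  rewrite !shD chN shN /clC /clC1 /clC2 /clS; field.
  by rewrite !gt_eqF.
have h : (s + k) * sh (s - k) < (s - k) * sh (s + k) by apply: sh_ratio_lt; lra.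
rewrite mulr_gt0 ?subr_gt0// divr_gt0 ?mulr_gt0// subr_gt0.
by apply: ltr_sqr_ge0 => //; exact: ltW.
Qed.

(** Source of the symmetry of the 2x2 system: through it the coefficient of psi'(0) in psi'''(0) is
    s^2 + k^2 minus the coefficient [stiff01] of psi(0) in psi''(0). *)
Lemma clD_sym s k : s != 0 -> k != 0 ->
  2 * clC s k * clC2 s k - clS s k * clC3 s k - clC1 s k ^+ 2 =
  (s ^+ 2 + k ^+ 2) * clD s k.
Proof.
move=> s0 k0; rewrite clDE//.
transitivity (2 * s ^+ 2 * (ch s ^+ 2 - sh s ^+ 2) + 2 * k ^+ 2 * (ch k ^+ 2 - sh k ^+ 2)
   - 2 * (s ^+ 2 + k ^+ 2) * ch s * ch k
   + (s ^+ 2 + k ^+ 2) * (k / s + s / k) * sh s * sh k); last first.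
  by rewrite !ch2_sub_sh2; ring.
rewrite /clC /clC1 /clC2 /clC3 /clS; field.
by rewrite s0 k0.
Qed.

(** For large s, [stiff00] behaves like (s^2 - k^2) k coth k; th is the tolerance. In the
    determinant 2 cosh s cosh k is at most 4 sinh s cosh k, hence at most th s sinh s, and the
    negative term of the numerator is dropped. *)
Lemma stiff00_le s k th : 0 < k -> k < s -> 1 <= s -> 4 * ch k <= th * s ->
  th < sh k / k -> stiff00 s k * (sh k / k - th) <= (s ^+ 2 - k ^+ 2) * ch k.
Proof.
move=> k0 ks s1 ths thX; have s0 := lt_trans k0 ks.
have D0 := clD_gt0 k0 ks.
have X0 : 0 < sh k / k - th by rewrite subr_gt0.
have sk : 0 < s ^+ 2 - k ^+ 2 by rewrite subr_gt0; apply: ltr_sqr_ge0 => //; exact: ltW.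
have shs0 := sh_gt0 s0; have shk0 := sh_gt0 k0; have chk0 := ch_gt0 k; have chs0 := ch_gt0 s.
rewrite /stiff00 mulrAC ler_pdivrMr//.
have -> : clC1 s k * clC2 s k - clC s k * clC3 s k =
   (s ^+ 2 - k ^+ 2) * (s * sh s * ch k - k * ch s * sh k).
  rewrite /clC /clC1 /clC2 /clC3; ring.
have Dge : s * sh s * (sh k / k - th) <= clD s k.
  rewrite clDE ?gt_eqF//.
  have t1 : 0 <= k / s * (sh s * sh k) by apply/ltW/mulr_gt0; [exact: divr_gt0|exact: mulr_gt0].
  have t2 := ler_wpM2r (ltW chk0) (ch_le_sh2 s1).
  have t3 := ler_wpM2r (ltW shs0) ths.
  have -> : (k / s + s / k) * sh s * sh k = k / s * (sh s * sh k) + s * sh s * (sh k / k).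
    by field; rewrite !gt_eqF.
  move: t1 t2 t3; set u := k / s * _; set v := sh k / k; lra.
have t4 := ler_wpM2r (ltW chk0) Dge.
have t5 : 0 <= k * ch s * sh k * (sh k / k - th).
  exact/ltW/(mulr_gt0 (mulr_gt0 (mulr_gt0 k0 chs0) shk0) X0).
have m : (s * sh s * ch k - k * ch s * sh k) * (sh k / k - th) <= ch k * clD s k.
  move: t4 t5; move: (sh k / k) => v; lra.
have := ler_wpM2l (ltW sk) m; move: (sh k / k) => v; lra.
Qed.

(** The combination p S' + q S in the distance t to the wall, with p and q given by Cramer's rule
    from the value a and slope b at the interface; e converts d/dt into d/dx. *)
Definition clamped s k e a b : R -> R :=
  let p := (clC s k * a - clS s k * e * b) / clD s k in
  let q := (clC s k * e * b - clC1 s k * a) / clD s k in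
  mode s k e (p, q / s, - p, - (q / k)).

Section Values.
Variables (s k e a b : R).
Hypotheses (k0 : 0 < k) (ks : k < s) (e1 : e = 1 \/ e = -1).
Let s0 : 0 < s := lt_trans k0 ks.
Let D0 : clD s k != 0. Proof. by rewrite gt_eqF// clD_gt0. Qed.
Let s_neq0 : s != 0. Proof. by rewrite gt_eqF. Qed.
Let k_neq0 : k != 0. Proof. by rewrite gt_eqF. Qed.
Lemma clamped0 : clamped s k e a b 0 = a.
Proof.
transitivity ((clC s k * a - clS s k * e * b) / clD s k * clC s k
   + (clC s k * e * b - clC1 s k * a) / clD s k * clS s k).
  rewrite /clamped /mode !chs0 !shs0 /clC /clS.
  by move: (clD s k) D0 (clC1 s k) => D HD X; field; rewrite s_neq0 k_neq0 HD.
move: D0; rewrite /clD; move: (clC s k) (clS s k) (clC1 s k) => C S C1 HD.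
by field; rewrite HD.
Qed.

Lemma clamped1 : derive1n 1 (clamped s k e a b) 0 = b.
Proof.
transitivity (e * ((clC s k * a - clS s k * e * b) / clD s k * clC1 s k
   + (clC s k * e * b - clC1 s k * a) / clD s k * clC s k)).
  rewrite derive1n_mode /= !chs0 !shs0 /clC /clS /clC1.
  by move: (clD s k) D0 => D HD; field; rewrite s_neq0 k_neq0 HD.
move: D0; rewrite /clD; move: (clC s k) (clS s k) (clC1 s k) => C S C1 HD.
by case: e1 => ->; field; rewrite HD.
Qed.

Lemma clamped2 : derive1n 2 (clamped s k e a b) 0 =
  stiff01 s k * a + e * stiff11 s k * b.
Proof.
transitivity ((clC s k * a - clS s k * e * b) / clD s k * clC2 s k
   + (clC s k * e * b - clC1 s k * a) / clD s k * clC1 s k).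
  rewrite derive1n_mode /= !chs0 !shs0 /clC /clS /clC1 /clC2.
  by move: (clD s k) D0 => D HD; case: e1 => ->; field; rewrite s_neq0 k_neq0 HD.
rewrite /stiff01 /stiff11; move: D0 (clC2 s k); rewrite /clD.
move: (clC s k) (clS s k) (clC1 s k) => C S C1 HD C2.
by field; rewrite HD.
Qed.

Lemma clamped3 : derive1n 3 (clamped s k e a b) 0 =
  - (e * stiff00 s k * a) + (s ^+ 2 + k ^+ 2 - stiff01 s k) * b.
Proof.
transitivity (e * ((clC s k * a - clS s k * e * b) / clD s k * clC3 s k
   + (clC s k * e * b - clC1 s k * a) / clD s k * clC2 s k)).
  rewrite derive1n_mode /= !chs0 !shs0 /clC /clS /clC1 /clC2 /clC3.
  by move: (clD s k) D0 => D HD; case: e1 => ->; field; rewrite s_neq0 k_neq0 HD.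
have -> : s ^+ 2 + k ^+ 2 =
   (2 * clC s k * clC2 s k - clS s k * clC3 s k - clC1 s k ^+ 2) / clD s k.
  by rewrite clD_sym// mulfK.
rewrite /stiff01 /stiff00; move: D0 (clC2 s k) (clC3 s k); rewrite /clD.
move: (clC s k) (clS s k) (clC1 s k) => C S C1 HD C2 C3.
by case: e1 => ->; field; rewrite HD.
Qed.

Lemma clamped_end x : e * x = -1 -> clamped s k e a b x = 0.
Proof.
move=> ex; rewrite /clamped /mode !(chs_end _ ex) !(shs_end _ ex).
by move: (_ / clD s k) => p; ring.
Qed.

Lemma clamped1_end x : e * x = -1 -> derive1n 1 (clamped s k e a b) x = 0.
Proof.
move=> ex; rewrite derive1n_mode /= !(chs_end _ ex) !(shs_end _ ex).
by move: (_ / clD s k) (_ / clD s k) => p q; field; rewrite s_neq0 k_neq0.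
Qed.

(** The operator factors through d^2/dx^2 - k^2, which kills the modes of rate k. On the modes of
    rate s the other factor is the defect of the characteristic relation. *)
Lemma clamped_ode rho mu B lam x : mu * lam * (s ^+ 2 - k ^+ 2) =
    lam ^+ 2 * rho + B ^+ 2 * k ^+ 2 ->
  ode_at rho mu B k lam (clamped s k e a b) x.
Proof.
move=> rel; rewrite /ode_at !derive1n_mode /clamped /=.
move: (_ / clD s k) (_ / clD s k) => q p.
move: (chs s e x) (shs s e x) (chs k e x) (shs k e x) => c1 c2 c3 c4.
apply/eqP; rewrite -subr_eq0; apply/eqP.
transitivity ((s ^+ 2 - k ^+ 2) * (p * c1 + q / s * c2) *
  (lam ^+ 2 * rho + B ^+ 2 * k ^+ 2 - mu * lam * (s ^+ 2 - k ^+ 2))).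
  by case: e1 => ->; field; rewrite s_neq0 k_neq0.
by rewrite rel subrr mulr0.
Qed.

Lemma clamped_smooth n x : derivable (derive1n n (clamped s k e a b)) x 1.
Proof. exact: derivable_mode. Qed.

End Values.
End Clamped.

(** * The dispersion relation *)

Section ContinuousAtReal.
Variable R : realType.
Implicit Types (f g h : R -> R) (x : R).

Lemma continuous_at_realM f g x : continuous_at x f -> continuous_at x g ->
  continuous_at x (fun y => f y * g y).
Proof. by move=> cf cg; apply: cvgM. Qed.

Lemma continuous_at_realD f g x : continuous_at x f -> continuous_at x g ->
  continuous_at x (fun y => f y + g y).
Proof. by move=> cf cg; apply: cvgD. Qed.

Lemma continuous_at_realB f g x : continuous_at x f -> continuous_at x g ->
  continuous_at x (fun y => f y - g y).
Proof. by move=> cf cg; apply: cvgB. Qed.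

Lemma continuous_at_realV f x : f x != 0 -> continuous_at x f ->
  continuous_at x (fun y => (f y)^-1).
Proof. by move=> f0 cf; apply: cvgV. Qed.

Lemma continuous_at_realX f n x : continuous_at x f ->
  continuous_at x (fun y => f y ^+ n).
Proof.
move=> cf; elim: n => [|n IH]; first exact: cvg_cst.
rewrite (_ : (fun y => _) = (fun y => f y * f y ^+ n)).
  exact: continuous_at_realM.
by apply/funext => y; rewrite exprS.
Qed.

Lemma continuous_at_real_comp h f x : continuous_at (f x) h -> continuous_at x f ->
  continuous_at x (fun y => h (f y)).
Proof. by move=> ch cf; apply: (@continuous_comp _ _ _ f h). Qed.

End ContinuousAtReal.

Ltac continuity_at_real :=
  repeat match goal with
  | |- continuous_at _ (fun _ => ?k) => exact: cvg_cst
  | |- continuous_at _ (fun y => y) => exact: cvg_id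
  | |- continuous_at _ (fun y => (@?f y * @?g y)%R) =>
      apply: (@continuous_at_realM _ f g)
  | |- continuous_at _ (fun y => (@?f y - @?g y)%R) =>
      apply: (@continuous_at_realB _ f g)
  | |- continuous_at _ (fun y => (@?f y + @?g y)%R) =>
      apply: (@continuous_at_realD _ f g)
  | |- continuous_at _ _ => assumption
  | |- continuous_at _ (fun y => ((@?f y)^-1)%R) =>
      apply: (@continuous_at_realV _ f)
  | |- continuous_at _ (fun y => (@?f y ^+ ?n)%R) =>
      apply: (@continuous_at_realX _ f n)
  | |- continuous_at _ (fun y => ch (@?f y)) =>
      apply: (@continuous_at_real_comp _ (@ch _) f); first exact: continuous_ch
  | |- continuous_at _ (fun y => sh (@?f y)) =>
      apply: (@continuous_at_real_comp _ (@sh _) f); first exact: continuous_sh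
  | |- continuous_at _ (fun y => Num.sqrt (@?f y)) =>
      apply: (@continuous_at_real_comp _ (@Num.sqrt _) f); first exact: sqrt_continuous
  end.

Section Dispersion.
Variables (R : realType) (grho rhop rhom mup mum B k : R).
Hypotheses (rhom0 : 0 < rhom) (rhomp : rhom < rhop) (mup0 : 0 < mup) (mum0 : 0 < mum).
Hypotheses (B0 : B != 0) (k0 : 0 < k).
Implicit Types (rho mu lam a b x : R).
Let rhop0 : 0 < rhop := lt_trans rhom0 rhomp.
Let B2 : 0 < B ^+ 2. Proof. by rewrite exprn_even_gt0. Qed.
Let k2 : 0 < k ^+ 2. Proof. by rewrite exprn_gt0. Qed.

Definition decay rho mu lam : R :=
  Num.sqrt (k ^+ 2 + (lam ^+ 2 * rho + B ^+ 2 * k ^+ 2) / (mu * lam)).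

Lemma decay_spec rho mu lam : 0 < rho -> 0 < mu -> 0 < lam ->
  k < decay rho mu lam /\
  mu * lam * (decay rho mu lam ^+ 2 - k ^+ 2) = lam ^+ 2 * rho + B ^+ 2 * k ^+ 2.
Proof.
move=> r0 m0 l0; have ml := mulr_gt0 m0 l0.
have p : 0 < (lam ^+ 2 * rho + B ^+ 2 * k ^+ 2) / (mu * lam).
  by apply: divr_gt0 => //; apply: addr_gt0; apply: mulr_gt0 => //; exact: exprn_gt0.
split.
  rewrite -[X in X < _](gtr0_norm k0) -sqrtr_sqr ltr_sqrt; first by rewrite ltrDl.
  exact: addr_gt0.
rewrite sqr_sqrtr; last exact/ltW/addr_gt0.
by rewrite addrC addKr mulrC mulfVK// gt_eqF.
Qed.

Lemma stiff_continuous s : k < s ->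
  [/\ continuous_at s (fun s => stiff00 s k), continuous_at s (fun s => stiff01 s k)
    & continuous_at s (fun s => stiff11 s k)].
Proof.
move=> ks; have D0 := clD_gt0 k0 ks.
have s0 : s != 0 by rewrite gt_eqF// (lt_trans k0).
have cS : continuous_at s (fun s => clS s k) by rewrite /clS; continuity_at_real.
have cC : continuous_at s (fun s => clC s k) by rewrite /clC; continuity_at_real.
have cC1 : continuous_at s (fun s => clC1 s k) by rewrite /clC1; continuity_at_real.
have cC2 : continuous_at s (fun s => clC2 s k) by rewrite /clC2; continuity_at_real.
have cC3 : continuous_at s (fun s => clC3 s k) by rewrite /clC3; continuity_at_real.
have cD : continuous_at s (fun s => (clD s k)^-1).
  by apply: continuous_at_realV; [rewrite gt_eqF|rewrite /clD; continuity_at_real].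
by split; [rewrite /stiff00|rewrite /stiff01|rewrite /stiff11]; continuity_at_real.
Qed.

Lemma decay_continuous rho mu lam : 0 < mu -> 0 < lam ->
  continuous_at lam (decay rho mu).
Proof.
move=> m0 l0; rewrite /decay; continuity_at_real.
by rewrite gt_eqF// mulr_gt0.
Qed.

(** Entries of the symmetric matrix M: M00 = [st00], M11 = [st11], M01 = - [st01]. The sides
    contribute to [st01] with opposite signs because they face the interface in opposite
    directions. *)
Definition st00 lam : R :=
  mup * lam * stiff00 (decay rhop mup lam) k + mum * lam * stiff00 (decay rhom mum lam) k.
Definition st11 lam : R :=
  mup * lam * stiff11 (decay rhop mup lam) k + mum * lam * stiff11 (decay rhom mum lam) k.
Definition st01 lam : R :=
  mup * lam * (k ^+ 2 + stiff01 (decay rhop mup lam) k)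
  - mum * lam * (k ^+ 2 + stiff01 (decay rhom mum lam) k).
Definition dispersion lam : R :=
  st00 lam * st11 lam - st01 lam ^+ 2 - grho * k ^+ 2 * st11 lam.

Lemma st11_gt0 lam : 0 < lam -> 0 < st11 lam.
Proof.
move=> l0; have [sp _] := decay_spec rhop0 mup0 l0.
have [sm _] := decay_spec rhom0 mum0 l0.
by apply: addr_gt0; apply: mulr_gt0 (mulr_gt0 _ l0) (stiff11_gt0 k0 _).
Qed.

Lemma dispersion_continuous lam : 0 < lam -> continuous_at lam dispersion.
Proof.
move=> l0; have [sp _] := decay_spec rhop0 mup0 l0.
have [sm _] := decay_spec rhom0 mum0 l0.
have [p00 p01 p11] := stiff_continuous sp; have [m00 m01 m11] := stiff_continuous sm.
have dp := @decay_continuous rhop _ _ mup0 l0; have dm := @decay_continuous rhom _ _ mum0 l0.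
have {}p00 := continuous_at_real_comp p00 dp; have {}p01 := continuous_at_real_comp p01 dp.
have {}p11 := continuous_at_real_comp p11 dp; have {}m00 := continuous_at_real_comp m00 dm.
have {}m01 := continuous_at_real_comp m01 dm; have {}m11 := continuous_at_real_comp m11 dm.
have c00 : continuous_at lam st00 by rewrite /st00; continuity_at_real.
have c11 : continuous_at lam st11 by rewrite /st11; continuity_at_real.
have c01 : continuous_at lam st01 by rewrite /st01; continuity_at_real.
by rewrite /dispersion; continuity_at_real.
Qed.

(** The choice a = M11, b = - M01 solves the homogeneous row of the system for every lam, leaving
    only the fourth jump condition as an equation for lam. *)
Definition profile lam x : R :=
  if x <= 0 then clamped (decay rhom mum lam) k 1 (st11 lam) (st01 lam) x
  else clamped (decay rhop mup lam) k (-1) (st11 lam) (st01 lam) x.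

Lemma profile_spec lam : 0 < lam ->
  [/\ quasi_solution rhop rhom mup mum B k lam (profile lam),
      force_jump rhop rhom mup mum k lam (profile lam) =
        st00 lam * st11 lam - st01 lam ^+ 2,
      profile lam 0 = st11 lam,
      smooth_open (profile lam) (-1) 0 & smooth_open (profile lam) 0 1].
Proof.
have n10 : (-1 : R) < 0 by lra.
have n01 : (0 : R) < 1 by lra.
have eL : (1 : R) * -1 = -1 by rewrite mul1r.
have eR : (-1 : R) * 1 = -1 by rewrite mulr1.
have oL : (1 : R) = 1 \/ (1 : R) = -1 by left.
have oR : (-1 : R) = 1 \/ (-1 : R) = -1 by right.
move=> l0; have [sp rp] := decay_spec rhop0 mup0 l0.
have [sm rm] := decay_spec rhom0 mum0 l0.
set a := st11 lam; set b := st01 lam.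
pose u := clamped (decay rhom mum lam) k 1 a b.
pose v := clamped (decay rhop mup lam) k (-1) a b.
have v0 : v 0 = a by exact: clamped0.
have u0 : u 0 = a by exact: clamped0.
have fu x : -1 <= x -> x <= 0 -> profile lam x = u x by rewrite /profile => _ ->.
have fv x : 0 <= x -> x <= 1 -> profile lam x = v x.
  move=> x0 _; move: x0; rewrite le_eqVlt => /predU1P[<-|x0].
    by rewrite (fu _ (ltW n10) (lexx _)) u0 v0.
  by rewrite /profile leNgt x0.
have du n x : derivable (derive1n n u) x 1 by exact: clamped_smooth.
have dv n x : derivable (derive1n n v) x 1 by exact: clamped_smooth.
have rl n := smooth_piece_rlim n01 fv dv n.
have ll n := smooth_piece_llim n10 fu du n.
have v1 : derive1n 1 v 0 = b by exact: clamped1.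
have u1 : derive1n 1 u 0 = b by exact: clamped1.
have v2 : derive1n 2 v 0 = _ := clamped2 a b k0 sp oR.
have u2 : derive1n 2 u 0 = _ := clamped2 a b k0 sm oL.
have v3 : derive1n 3 v 0 = _ := clamped3 a b k0 sp oR.
have u3 : derive1n 3 u 0 = _ := clamped3 a b k0 sm oL.
have p0 : profile lam 0 = a by rewrite (fu _ (ltW n10) (lexx _)).
split; last 3 first.
- exact: p0.
- exact: smooth_piece_open fu du.
- exact: smooth_piece_open fv dv.
- refine (conj (smooth_piece_Ck n10 fu du 4) (conj (smooth_piece_Ck n01 fv dv 4)
    (conj _ (conj _ (conj _ (conj _ (conj _ (conj _ (conj _ _))))))))).
  + move=> x /andP[x0 x1].
    have E n : derive1n n (profile lam) x = derive1n n v x.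
      by apply: eq_derive1n_oo x0 x1 => y y0 y1; apply: fv; exact: ltW.
    have := clamped_ode a b k0 sp oR x rp; rewrite -/v /ode_at.
    by rewrite (E 0%N) (E 2%N) (E 4%N).
  + move=> x /andP[x0 x1].
    have E n : derive1n n (profile lam) x = derive1n n u x.
      by apply: eq_derive1n_oo x0 x1 => y y0 y1; apply: fu; exact: ltW.
    have := clamped_ode a b k0 sm oL x rm; rewrite -/u /ode_at.
    by rewrite (E 0%N) (E 2%N) (E 4%N).
  + by rewrite rl ll v1 u1.
  + rewrite !rl !ll v2 u2 [derive1n 0 v 0]v0 [derive1n 0 u 0]u0 /a /b /st11 /st01.
    move: (stiff01 _ _) (stiff01 _ _) (stiff11 _ _) (stiff11 _ _) => *; ring.
  + by rewrite (fu _ (lexx _) (ltW n10)) /u (clamped_end _ _ _ _ eL).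
  + by rewrite (fv _ (ltW n01) (lexx _)) /v (clamped_end _ _ _ _ eR).
  + by rewrite (smooth_piece_rlim n10 fu du) /u (clamped1_end _ _ k0 sm eL).
  + by rewrite (smooth_piece_llim n01 fv dv) /v (clamped1_end _ _ k0 sp eR).
- rewrite /force_jump !rl !ll v1 u1 v3 u3.
  (* The characteristic relation eliminates the squared rates: the lam^2 rho terms cancel the
     inertial part of the jump, and the B^2 terms cancel between the sides. *)
  have ep : mup * lam * decay rhop mup lam ^+ 2 =
    lam ^+ 2 * rhop + B ^+ 2 * k ^+ 2 + mup * lam * k ^+ 2 by rewrite -rp; ring.
  have em : mum * lam * decay rhom mum lam ^+ 2 =
    lam ^+ 2 * rhom + B ^+ 2 * k ^+ 2 + mum * lam * k ^+ 2 by rewrite -rm; ring.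
  transitivity (st00 lam * a +
    ((mup * lam * decay rhop mup lam ^+ 2) - (mum * lam * decay rhom mum lam ^+ 2)
     - mup * lam * (2 * k ^+ 2 + stiff01 (decay rhop mup lam) k)
     + mum * lam * (2 * k ^+ 2 + stiff01 (decay rhom mum lam) k)
     - lam ^+ 2 * rhop + lam ^+ 2 * rhom) * b).
    by rewrite /st00; ring.
  by rewrite ep em /b /st01; ring.
Qed.

(** With a = M11, the energy inequality for the profile and 2 a^2 <= int psi'^2 give a det M >= 2
    lam^2 rhom a^2 >= grho k^2 a^2; then divide by a > 0. *)
Lemma dispersion_ge0 lam : 0 < lam -> grho * k ^+ 2 <= 2 * (lam ^+ 2 * rhom) ->
  0 <= dispersion lam.
Proof.
move=> l0 hl; have [qs fj p0 _ _] := profile_spec l0.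
have [q [H en]] := quasi_solution_energy (ltW rhom0) (ltW rhomp) (ltW mup0) (ltW mum0) (ltW l0) qs.
have a0 := st11_gt0 l0.
move: en; rewrite fj p0 => en.
have s0 := H01_sqr0_le H; rewrite p0 in s0.
have n1 : 0 <= B ^+ 2 * k ^+ 2 * (k ^+ 2 * L2sq (profile lam) + L2sq q).
  apply: mulr_ge0; first exact/ltW/mulr_gt0.
  by apply: addr_ge0; [apply: mulr_ge0 => //; [exact: ltW|exact: L2sq_ge0]|exact: L2sq_ge0].
have lr : 0 <= lam ^+ 2 * rhom by apply: mulr_ge0; [exact: sqr_ge0|exact: ltW].
have n2 := ler_wpM2l lr s0.
have n3 := ler_wpM2r (sqr_ge0 (st11 lam)) hl.
rewrite -(pmulr_rge0 _ a0) /dispersion; clear - en n1 n2 n3.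
move: n1 n2 n3 en; move: (st11 lam) (st00 lam) (st01 lam) (L2sq q) => *; lra.
Qed.

(** As lam tends to 0 the rates s blow up while mu lam (s^2 - k^2) tends to B^2 k^2, so each side
    contributes about B^2 k^3 coth k to [st00]. A small explicit lam keeps each share below half of
    grho k^2. *)
Lemma dispersion_lt0 : B ^+ 2 * (2 * k * ch k) < grho * sh k ->
  exists2 lam, 0 < lam <= 1 & dispersion lam < 0.
Proof.
move=> hB.
(* [H] is the share of gravity allotted to each side; the hypothesis becomes B^2 k^2 Y < H X. *)
pose H := grho * k ^+ 2 / 2; pose X := sh k / k; pose Y := ch k.
have Y0 : 0 < Y by exact: ch_gt0.
have X0 : 0 < X by apply: divr_gt0 => //; exact: sh_gt0.
have kX : k * X = sh k by rewrite /X mulrC mulfVK// gt_eqF.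
have hHX : B ^+ 2 * k ^+ 2 * Y < H * X.
  have : 0 < k / 2 by exact: divr_gt0.
  move=> /ltr_pM2l h; move: hB; rewrite -h -kX /H -/Y => hB; lra.
have H0 : 0 < H.
  rewrite -(pmulr_lgt0 _ X0); apply: lt_trans hHX.
  by apply: mulr_gt0 => //; exact: mulr_gt0.
(* The inequality [key] requires th (Y + H) to be less than the gap H X - B^2 k^2 Y; this th uses
   half of it. *)
pose th := (H * X - B ^+ 2 * k ^+ 2 * Y) / (2 * (Y + H)).
have thE : th * (2 * (Y + H)) = H * X - B ^+ 2 * k ^+ 2 * Y.
  by rewrite /th mulfVK// gt_eqF//; lra.
have th0 : 0 < th by apply: divr_gt0; lra.
have BY : 0 < B ^+ 2 * k ^+ 2 * Y by apply: mulr_gt0 => //; exact: mulr_gt0.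
have thX : th < X.
  rewrite /th ltr_pdivrMr; last by lra.
  have : 0 < X * Y by exact: mulr_gt0.
  have : 0 < X * H by exact: mulr_gt0.
  lra.
have key : (B ^+ 2 * k ^+ 2 + th) * Y < H * (X - th).
  have : 0 < th * (Y + H) by apply: mulr_gt0 => //; lra.
  lra.
(* A rate s >= K satisfies both s >= 1 and 4 Y <= th s, as [stiff00_le] demands. *)
pose K := 1 + 4 * Y / th.
have Yth : 0 < 4 * Y / th by apply: divr_gt0 => //; lra.
have K1 : 1 <= K by rewrite /K; lra.
have BK mu : 0 < mu -> 0 < B ^+ 2 * k ^+ 2 / (mu * K ^+ 2).
  by move=> m0; apply: divr_gt0; apply: mulr_gt0 => //; apply: exprn_gt0; lra.
(* The bounds 1 and th / rhop ensure lam^2 rho <= th on both sides; the other two force the rates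
   above [K]. *)
pose lam := Num.min (Num.min 1 (th / rhop))
  (Num.min (B ^+ 2 * k ^+ 2 / (mup * K ^+ 2)) (B ^+ 2 * k ^+ 2 / (mum * K ^+ 2))).
have l0 : 0 < lam by rewrite !lt_min ltr01 divr_gt0// !BK.
have : lam <= lam by [].
rewrite {2}/lam !le_min => /andP[/andP[l1 l2] /andP[l3 l4]].
exists lam; first by rewrite l0.
have side rho mu : 0 < rho -> rho <= rhop -> 0 < mu ->
    lam <= B ^+ 2 * k ^+ 2 / (mu * K ^+ 2) ->
    mu * lam * stiff00 (decay rho mu lam) k < H.
  move=> r0 rr m0 lK; have [ks rel] := decay_spec r0 m0 l0.
  set s := decay rho mu lam in ks rel *.
  have ml := mulr_gt0 m0 l0.
  have Ks : K <= s.
    rewrite -(ler_pXn2r (n := 2))// ?nnegrE; [|lra|by apply/ltW/(lt_trans k0)].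
    rewrite -(ler_pM2l ml).
    move: lK; rewrite ler_pdivlMr; last by apply: mulr_gt0 => //; apply: exprn_gt0; lra.
    have t1 : 0 < mu * lam * k ^+ 2 by exact: mulr_gt0.
    have t2 : 0 <= lam ^+ 2 * rho by apply: mulr_ge0; [exact: sqr_ge0|exact: ltW].
    move: rel; lra.
  have Ys : 4 * Y <= th * s.
    have := ler_wpM2l (ltW th0) Ks; rewrite /K.
    have -> : th * (1 + 4 * Y / th) = th + 4 * Y by field; rewrite gt_eqF.
    lra.
  have := stiff00_le k0 ks (le_trans K1 Ks) Ys thX => le0.
  have Xth : 0 < X - th by lra.
  rewrite -(ltr_pM2r Xth); apply: le_lt_trans key.
  have -> : mu * lam * stiff00 s k * (X - th) =
    mu * lam * (stiff00 s k * (X - th)) by rewrite mulrA.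
  apply: le_trans (ler_wpM2l (ltW ml) le0) _.
  rewrite mulrA rel -/Y ler_pM2r// addrC lerD2l.
  have t1 : lam ^+ 2 <= lam by rewrite expr2 ger_pMl.
  have t2 : lam * rhop <= th by rewrite -ler_pdivlMr.
  apply: le_trans (ler_wpM2r (ltW r0) t1) _; apply: le_trans t2.
  by rewrite ler_pM2l.
have sp := side rhop mup rhop0 (lexx _) mup0 l3.
have sm := side rhom mum rhom0 (ltW rhomp) mum0 l4.
have a0 := st11_gt0 l0.
have lt00 : st00 lam - 2 * H < 0 by rewrite /st00; lra.
have : (st00 lam - 2 * H) * st11 lam < 0 by rewrite nmulr_rlt0.
have := sqr_ge0 (st01 lam); rewrite /dispersion.
have -> : grho * k ^+ 2 = 2 * H by rewrite /H; field.
move: (st00 lam) (st11 lam) => x y; lra.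
Qed.

(** The intermediate value theorem between a small lam, where [dispersion] is negative, and a large
    one, where it is nonnegative; at a root the fourth jump condition holds. *)
Lemma exists_profile g : grho = g * (rhop - rhom) -> k < xihc grho B ->
  exists lam, exists psi, [/\ 0 < lam,
    is_solution g rhop rhom mup mum B k lam psi,
    smooth_open psi (-1) 0, smooth_open psi 0 1 & psi 0 != 0].
Proof.
move=> gE /(lt_critical_frequency B0 k0)/dispersion_lt0[l1 /andP[l10 l11] neg].
(* As l2 >= 1, l2^2 rhom >= l2 rhom = rhom + |grho| k^2, enough for [dispersion_ge0]. *)
pose l2 : R := 1 + `|grho| * k ^+ 2 / rhom.
have n0 : 0 <= `|grho| * k ^+ 2 / rhom.
  by apply: divr_ge0; [apply: mulr_ge0 => //; exact: ltW|exact: ltW].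
have l21 : 1 <= l2 by rewrite /l2; lra.
have pos : 0 <= dispersion l2.
  apply: dispersion_ge0; first by lra.
  apply: le_trans (ler_wpM2r (ltW k2) (ler_norm grho)) _.
  have t : l2 * rhom = rhom + `|grho| * k ^+ 2 by rewrite /l2; field; rewrite gt_eqF.
  have t2 : l2 <= l2 ^+ 2 by rewrite expr2 ler_peMl//; lra.
  have t3 := ler_wpM2r (ltW rhom0) t2; rewrite t in t3.
  have t4 := ltW rhom0; have t5 := mulr_ge0 (normr_ge0 grho) (sqr_ge0 k).
  have t6 : `|grho| * k ^+ 2 <= l2 ^+ 2 * rhom.
    by apply: le_trans t3; rewrite lerDr.
  by apply: (le_trans t6); rewrite mulr_natl mulr2n lerDl; exact: le_trans t5 t6.
have le12 : l1 <= l2 by lra.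
have cts : {within `[l1, l2], continuous dispersion}.
  apply: continuous_in_subspaceT => x; rewrite inE/= in_itv/= => /andP[x1 _].
  by apply: dispersion_continuous; exact: lt_le_trans x1.
have bracket : Num.min (dispersion l1) (dispersion l2) <= 0 <=
    Num.max (dispersion l1) (dispersion l2).
  by rewrite ge_min (ltW neg) le_max pos orbT.
have [lam] := IVT le12 cts bracket; rewrite in_itv/= => /andP[h1 _] root.
have l0 : 0 < lam by exact: lt_le_trans h1.
have [qs fj p0 sl sr] := profile_spec l0.
exists lam, (profile lam); split => //; last by rewrite p0 gt_eqF ?st11_gt0.
apply/is_solutionP; split => //; rewrite fj p0 -gE.
by apply/eqP; rewrite -subr_eq0; apply/eqP.
Qed.

End Dispersion.

(** * Absence of growing modes, and evenness in the frequency *)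

Section MainTheorem.
Variable R : realType.
Implicit Types (g rhop rhom mup mum B xi lam : R) (psi : R -> R).

(** Common core of (i) and (ii): when magnetic energy dominates gravity, the energy inequality
    leaves lam^2 rhom int psi'^2 <= 0, and [H01_sqr_le] forces psi = 0. *)
Lemma solution_trivial g rhop rhom mup mum B xi lam psi :
  0 < rhom -> rhom < rhop -> 0 < mup -> 0 < mum -> 0 < lam ->
  (forall dpsi, H01 psi dpsi ->
    g * (rhop - rhom) * psi 0 ^+ 2 <= B ^+ 2 * (xi ^+ 2 * L2sq psi + L2sq dpsi)) ->
  is_solution g rhop rhom mup mum B xi lam psi -> ~ nontrivial psi.
Proof.
move=> rm0 rmp mp0 mm0 l0 hpsi /is_solutionP[qs fj] [x [/andP[x1 x2] /negP[]]].
have [q [H en]] := quasi_solution_energy (ltW rm0) (ltW rmp) (ltW mp0) (ltW mm0) (ltW l0) qs.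
have := ler_wpM2l (sqr_ge0 xi) (hpsi q H); rewrite fj in en => hx.
have lr : 0 < lam ^+ 2 * rhom by apply: mulr_gt0 => //; exact: exprn_gt0.
have le0 : lam ^+ 2 * rhom * L2sq q <= 0.
  move: hx en; move: (L2sq q) (L2sq psi) (psi 0); clear => *; lra.
have L0 : L2sq q <= 0 by rewrite -(pmulr_rle0 _ lr).
have := H01_sqr_le H x1 x2 => hsq.
rewrite -sqrf_eq0; apply/eqP/le_anti; rewrite sqr_ge0 andbT.
by apply: le_trans hsq _; rewrite pmulr_rle0.
Qed.

(** The frequency enters only through xi^2 and xi^4. *)
Lemma is_solutionN g rhop rhom mup mum B xi lam psi :
  is_solution g rhop rhom mup mum B (- xi) lam psi <->
  is_solution g rhop rhom mup mum B xi lam psi.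
Proof.
have e2 : (- xi) ^+ 2 = xi ^+ 2 by rewrite sqrrN.
have e4 : (- xi) ^+ 4 = xi ^+ 4 by ring.
by rewrite /is_solution /ode_at e2 e4.
Qed.

End MainTheorem.
Unset Implicit Arguments.

Theorem theorem2p2 (R : realType) (g rhop rhom mup mum B : R) :
  0 < g -> 0 < rhom -> rhom < rhop -> 0 < mup -> 0 < mum -> B != 0 ->
  (* (i) *)
  (Bc (g * (rhop - rhom)) <= `|B| ->
     forall xi lam psi, 0 < lam ->
       is_solution g rhop rhom mup mum B xi lam psi -> ~ nontrivial psi) /\
  (* (ii) *)
  (`|B| < Bc (g * (rhop - rhom)) ->
     forall xi, xihc (g * (rhop - rhom)) B <= `|xi| ->
     forall lam psi, 0 < lam ->
       is_solution g rhop rhom mup mum B xi lam psi -> ~ nontrivial psi) /\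
  (* (iii) *)
  (`|B| < Bc (g * (rhop - rhom)) ->
     exists (Lam : R -> R) (Psi : R -> R -> R),
       forall xi, 0 < `|xi| < xihc (g * (rhop - rhom)) B ->
         0 < Lam xi /\
         is_solution g rhop rhom mup mum B xi (Lam xi) (Psi xi) /\
         Lam (- xi) = Lam xi /\
         (forall x, -1 <= x <= 1 -> Psi (- xi) x = Psi xi x) /\
         smooth_open (Psi xi) (-1) 0 /\ smooth_open (Psi xi) 0 1 /\
         Psi xi 0 != 0).
Proof.
move=> g0 rm0 rmp mp0 mm0 B0.
have gr0 : 0 < g * (rhop - rhom) by apply: mulr_gt0 => //; rewrite subr_gt0.
split; [|split].
- move=> hB xi lam psi l0; apply: solution_trivial => // dpsi H.
  apply: le_trans (magnetic_number_bound gr0 hB H) _.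
  rewrite ler_wpM2l ?sqr_ge0// lerDr.
  by apply: mulr_ge0; [exact: sqr_ge0|exact: L2sq_ge0].
- move=> _ xi hx lam psi l0; apply: solution_trivial => // dpsi H.
  exact: critical_frequency_bound.
move=> _.
(* Stated as an implication so that [choice] applies at every k; outside the subcritical range any
   pair will do. *)
pose good k (p : R * (R -> R)) := 0 < k < xihc (g * (rhop - rhom)) B ->
  [/\ 0 < p.1, is_solution g rhop rhom mup mum B k p.1 p.2,
    smooth_open p.2 (-1) 0, smooth_open p.2 0 1 & p.2 0 != 0].
have ex k : exists p, good k p.
  have [/andP[k0 kx]|nk] := pselect (is_true (0 < k < xihc (g * (rhop - rhom)) B)).
    have [lam [psi h]] := exists_profile rm0 rmp mp0 mm0 B0 k0 erefl kx.
    by exists (lam, psi) => _.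
  by exists (0, fun=> 0) => /nk.
have [F FP] := choice ex.
(* Selecting the pair at |xi| makes evenness immediate; for negative xi the solution is carried over
   by [is_solutionN]. *)
exists (fun xi => (F `|xi|).1), (fun xi => (F `|xi|).2) => xi hxi.
have [l0 sol sl sr p0] := FP _ hxi.
rewrite normrN.
have sol' : is_solution g rhop rhom mup mum B xi (F `|xi|).1 (F `|xi|).2.
  move: sol; move: (F `|xi|) => p.
  by have [_|_ /is_solutionN] := ger0P xi.
refine (conj l0 (conj sol' (conj erefl (conj _ (conj sl (conj sr p0)))))).
by move=> x _.
Qed.
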